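(* Let $p$ be a prime and let $W$ be a DVR with quotient field $\mathbb{Q}(X)$ such that $W\cap\mathbb{Q}=\mathbb{Z}_{(p)}$ and $X\in W$. Then $W$ is unramified over $\mathbb{Z}_{(p)}$ (i.e. $e(W\mid\mathbb{Z}_{(p)})=1$) if and only if there exists an admissible pair $(\alpha,\delta)\in\mathbb{O}_p^{\mathrm{br}}\times(\mathbb{Z}_{\ge0}\cup\{\infty\})$, which is a minimal pair when $\delta<\infty$, such that $W=\mathbb{Z}_{(p),\alpha,\delta}$ and $\mathbb{Q}_p(\alpha)/\mathbb{Q}_p$ is unramified.
   Context: Fix a prime $p$. $\overline{\mathbb{Q}_p}$ is an algebraic closure of $\mathbb{Q}_p$, $v_p$ the unique extension of the $p$-adic valuation, $\mathbb{C}_p$ the completion of $\overline{\mathbb{Q}_p}$, $\mathbb{O}_p=\{x\in\mathbb{C}_p:v_p(x)\ge0\}$. $\mathbb{C}_p^{\mathrm{br}}$ is the set of $\alpha\in\mathbb{C}_p$ such that the ramification index of $\mathbb{Q}_p(\alpha)/\mathbb{Q}_p$ (index of $\mathbb{Z}$ in $v_p(\mathbb{Q}_p(\alpha)^* )$) is finite; $\mathbb{Q}_p(\alpha)/\mathbb{Q}_p$ is unramified if this index is $1$; $\mathbb{O}_p^{\mathrm{br}}=\mathbb{O}_p\cap\mathbb{C}_p^{\mathrm{br}}$. A pair $(\alpha,\delta)\in\mathbb{C}_p\times(\mathbb{Q}\cup\{\infty\})$ is admissible if: when $\delta\in\mathbb{Q}$, $\alpha\in\overline{\mathbb{Q}_p}$;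 when $\delta=\infty$, $\alpha$ is transcendental over $\mathbb{Q}$. A pair $(\alpha,\delta)\in\overline{\mathbb{Q}_p}\times\mathbb{Q}$ is minimal if every $\beta\in\overline{\mathbb{Q}_p}$ with $v_p(\beta-\alpha)\ge\delta$ satisfies $[\mathbb{Q}_p(\beta):\mathbb{Q}_p]\ge[\mathbb{Q}_p(\alpha):\mathbb{Q}_p]$. For $\delta\in\mathbb{Q}$, $v_{p,\alpha,\delta}$ is the monomial valuation on $\mathbb{C}_p(X)$ given on polynomials by $v_{p,\alpha,\delta}(\sum_i a_i(X-\alpha)^i)=\min_i\{v_p(a_i)+i\delta\}$; for $\delta=\infty$, $v_{p,\alpha,\infty}(\varphi)=v_p(\varphi(\alpha))$ for $\varphi\in\mathbb{Q}(X)$. $\mathbb{Z}_{(p),\alpha,\delta}=\{\varphi\in\mathbb{Q}(X):v_{p,\alpha,\delta}(\varphi)\ge0\}$. $e(W\mid\mathbb{Z}_{(p)})$ is the index of the value group of $\mathbb{Z}_{(p)}$ in that of $W$. *)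

(* Defs.v *)
From HB Require Import structures.
From mathcomp Require Import all_boot all_order all_algebra.
From mathcomp Require Import fraction.
Set Implicit Arguments. Unset Strict Implicit. Unset Printing Implicit Defensive.
Import Order.TTheory GRing.Theory Num.Theory.
Local Open Scope ring_scope.

Definition padicv (p : nat) (q : rat) : rat :=
  (logn p (absz (numq q)))%:R - (logn p (absz (denq q)))%:R.

(** * An abstract model of (C_p, v_p).
   [K] with [v : K -> rat] (the value of [v 0] is irrelevant; 0 has
   valuation +oo) is a model of C_p when: K is algebraically closed of
   characteristic 0, v is a valuation extending v_p on Q, K is complete
   for v, and the algebraic closure of Q is dense in K.  Every such
   valued field is isomorphic to C_p. *)
Section Cp.
Variables (p : nat) (K : closedFieldType) (v : K -> rat).

Definition vge (x : K) (d : rat) : bool := (x == 0) || (d <= v x).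

Definition alg_over_Q (x : K) : Prop :=
  exists P : {poly rat}, P != 0 /\ root (map_poly ratr P) x.

Definition is_Cp : Prop :=
  [/\ (forall n : nat, (0 < n)%N -> n%:R != 0 :> K) /\
      (forall x y : K, x != 0 -> y != 0 -> v (x * y) = v x + v y),
      (forall x y : K, x != 0 -> y != 0 -> x + y != 0 ->
                      Order.min (v x) (v y) <= v (x + y)),
      (forall q : rat, q != 0 -> v (ratr q) = padicv p q),
      (forall u : nat -> K,
         (forall N : nat, exists M : nat, forall m n : nat,
             (M <= m)%N -> (M <= n)%N -> vge (u m - u n) N%:R) ->
         exists l : K, forall N : nat, exists M : nat, forall n : nat,
             (M <= n)%N -> vge (u n - l) N%:R) &
      (forall (x : K) (N : nat), exists y : K, alg_over_Q y /\ vge (x - y) N%:R)].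

Definition inQp (x : K) : Prop := forall N : nat, exists q : rat, vge (x - ratr q) N%:R.

Definition polyQp (P : {poly K}) : Prop := forall i : nat, inQp P`_i.

Definition alg_Qp (a : K) : Prop := exists P : {poly K}, P != 0 /\ polyQp P /\ root P a.

Definition deg_Qp_le (a : K) (n : nat) : Prop :=
  exists P : {poly K}, [/\ P != 0, polyQp P, root P a & ((size P).-1 <= n)%N].

Definition deg_Qp_leq (a b : K) : Prop := forall n : nat, deg_Qp_le b n -> deg_Qp_le a n.

Definition transcendental_Q (a : K) : Prop :=
  forall P : {poly rat}, P != 0 -> ~~ root (map_poly ratr P) a.

Definition in_value_group (a : K) (g : rat) : Prop :=
  exists f h : {poly K}, [/\ polyQp f, polyQp h, f.[a] != 0, h.[a] != 0 &
                             g = v f.[a] - v h.[a]].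

Definition is_intq (q : rat) : bool := denq q == 1.

(* the index of Z in v(Q_p(a)^* ) is finite: finitely many cosets *)
Definition finite_ram (a : K) : Prop :=
  exists s : seq rat, forall g : rat, in_value_group a g ->
    exists2 r, r \in s & is_intq (g - r).

Definition unramified_Qp (a : K) : Prop :=
  forall g : rat, in_value_group a g -> is_intq g.

Definition in_Op (a : K) : Prop := vge a 0.
Definition in_Cpbr (a : K) : Prop := finite_ram a.

(* admissible pair, delta in Q \cup {oo} (None = oo) *)
Definition admissible (a : K) (d : option rat) : Prop :=
  match d with Some _ => alg_Qp a | None => transcendental_Q a end.

Definition minimal_pair (a : K) (d : rat) : Prop :=
  alg_Qp a /\
  forall b : K, alg_Qp b -> vge (b - a) d -> deg_Qp_leq a b.

(* coefficients of f in the basis (X - a)^i *)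
Definition shiftc (a : K) (f : {poly rat}) : {poly K} :=
  (map_poly ratr f) \Po ('X + a%:P).

(* v_{p,a,d}(f) >= v_{p,a,d}(g)  (monomial valuation, f g in Q[X], g != 0) *)
Definition mon_ge (a : K) (d : rat) (f g : {poly rat}) : Prop :=
  forall i : nat, (shiftc a f)`_i != 0 ->
    exists j : nat, (shiftc a g)`_j != 0 /\
      v (shiftc a g)`_j + j%:R * d <= v (shiftc a f)`_i + i%:R * d.

End Cp.

Definition QX := {fraction {poly rat}}.
Definition toQX (f : {poly rat}) : QX := @FracField.tofrac _ f.
Definition ratQX (q : rat) : QX := toQX q%:P.

(* Z_{(p),a,d} for d in Z_{>=0} \cup {oo} (None = oo) *)
Definition inZpad (K : closedFieldType) (v : K -> rat) (a : K) (d : option nat)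
    (phi : QX) : Prop :=
  exists f g : {poly rat}, [/\ g != 0, phi = toQX f / toQX g &
    match d with
    | Some n => mon_ge v a n%:R f g
    | None => (map_poly ratr f).[a] = 0 \/
              v (map_poly ratr g).[a] <= v (map_poly ratr f).[a]
    end].

Definition is_DVR (W : pred QX) : Prop :=
  exists w : QX -> int,
    [/\ (forall x y : QX, x != 0 -> y != 0 -> w (x * y) = w x + w y),
        (forall x y : QX, x != 0 -> y != 0 -> x + y != 0 ->
                         Order.min (w x) (w y) <= w (x + y)),
        (forall n : int, exists2 x : QX, x != 0 & w x = n) &
        (forall x : QX, x \in W <-> (x = 0 \/ 0 <= w x))].

(* e(W | Z_(p)) = 1 : the value group of Z_(p) (image of Q^* ) is all of
   Q(X)^* / W^x . *)
Definition unramified_W (W : pred QX) : Prop :=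
  forall x : QX, x != 0 -> exists q : rat,
    [/\ q != 0, x / ratQX q \in W & ratQX q / x \in W].

(* Main.v *)
Require Import Defs.
From HB Require Import structures.
From mathcomp Require Import all_boot all_order all_algebra.
From mathcomp Require Import fraction.
From mathcomp Require Import generic_quotient ring lra.
From mathcomp Require boolp classical_sets.
Import Order.TTheory GRing.Theory Num.Theory.
Local Open Scope ring_scope.

Set Implicit Arguments. Unset Strict Implicit. Unset Printing Implicit Defensive.

(** Let L = K(X), containing K = C_p and Q(X).  If W is unramified, then p stays
    a nonunit in the compositum of W and O_v, because O_v is faithfully flat over
    Z_(p); a subring of L maximal among those that contain the compositum but not
    1/p is a valuation ring U extending both v and W.

    The closure of W in U for the p-adic topology is a ring in which every nonunit
    is divisible by p, and it contains every Teichmuller representative congruent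
    to one of its elements.  Starting from X one therefore subtracts Teichmuller
    representatives digit by digit: b_n = sum_(i < n) p^i tau_i is in the closure
    and Y_n = (X - b_n) / p^n is in U.  If the residue of Y_n is transcendental for
    some n, then U induces the monomial valuation at (b_n, n); otherwise b_n tends
    to some a with X - a divisible in U by all powers of p, which is the case
    delta = oo.  Either way a lies in the closure, so Q_p(a) has integral values.

    For minimality, let v(b - b_n) >= n with b algebraic: Q_p[b] is closed, being
    finite dimensional, and each tau_i is a limit of powers of (b - b_i) / p^i, so
    b_n lies in Q_p[b].

    Conversely, when Q_p(a) is unramified the valuation of each element of Q(X) is
    an integer, hence the valuation of a power of p. *)

(** * Maximal subrings avoiding 1/p *)


Section Chevalley.
Variable L : fieldType.
Implicit Types (A B : L -> Prop) (x y z p : L).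

Record subring_without p A : Prop := SubringWithout {
  sw1 : A 1;
  swB : forall x y, A x -> A y -> A (x - y);
  swM : forall x y, A x -> A y -> A (x * y);
  swV : ~ A p^-1 }.

Definition maximal_without p A :=
  subring_without p A /\
  forall B, subring_without p B -> (forall x, A x -> B x) ->
    forall x, B x -> A x.

(** Zorn's lemma is applied to the sets [X] for which [A0] union [X] is such a subring. With this
    encoding the union of the empty chain gives [A0] itself, which is covered by the hypothesis. *)
Lemma ex_maximal_without p A0 : subring_without p A0 ->
  exists A, maximal_without p A /\ forall x, A0 x -> A x.
Proof.
move=> A0ring.
pose P (X : L -> Prop) := subring_without p (fun x => A0 x \/ X x).
have [F FP Ftot|A [PA Amax]] := @classical_sets.Zorn_bigcup L P.
  have common x y : A0 x \/ (exists2 X, F X & X x) -> A0 y \/ (exists2 X, F X & X y) ->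
    (A0 x /\ A0 y) \/ exists X, [/\ F X, A0 x \/ X x & A0 y \/ X y].
    move=> [A0x|[X FX Xx]] [A0y|[Y FY Yy]].
    - by left.
    - by right; exists Y; split=> //; [left|right].
    - by right; exists X; split=> //; [right|left].
    - right; case: (Ftot X Y FX FY) => [XY|YX].
      + by exists Y; split=> //; right=> //; apply: XY.
      + by exists X; split=> //; right=> //; apply: YX.
  split.
  - by left; case: A0ring.
  - move=> x y Hx Hy; case: (common x y Hx Hy) => [[Ax Ay]|[X [FX Xx Xy]]].
      by left; apply: (swB A0ring).
    by case: (swB (FP X FX) Xx Xy); [left|right; exists X].
  - move=> x y Hx Hy; case: (common x y Hx Hy) => [[Ax Ay]|[X [FX Xx Xy]]].
      by left; apply: (swM A0ring).
    by case: (swM (FP X FX) Xx Xy); [left|right; exists X].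
  - case=> [Ap|[X FX Xp]]; first exact: (swV A0ring).
    by apply: (swV (FP X FX)); right.
exists (fun x => A0 x \/ A x); split; last by left.
split=> // B Bring AB x Bx; right.
have PB : P B.
  have e y : B y -> A0 y \/ B y by right.
  have e' y : A0 y \/ B y -> B y by case=> // H; apply: AB; left.
  split; first by apply: e; case: Bring.
  - by move=> y z /e' Hy /e' Hz; apply/e/(swB Bring).
  - by move=> y z /e' Hy /e' Hz; apply/e/(swM Bring).
  - by move/e'; apply: (swV Bring).
apply: boolp.contrapT => nAx; apply: (Amax B) => //.
split; first by move=> y Ay; apply: AB; right.
by move/(_ x Bx).
Qed.

Section Maximal.
Variables (p : L) (A : L -> Prop).
Hypotheses (p0 : p != 0) (Ap : A p) (Amax : maximal_without p A).

Let Aring := Amax.1.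
Let A1 : A 1 := sw1 Aring.
Let A0 : A 0. Proof. by rewrite -(subrr 1); apply: (swB Aring). Qed.
Let AN x : A x -> A (- x). Proof. by rewrite -sub0r; apply: (swB Aring). Qed.
Let AD x y : A x -> A y -> A (x + y).
Proof. by move=> Ax Ay; rewrite -(opprK y); apply: (swB Aring) => //; apply: AN. Qed.
Let AM x y : A x -> A y -> A (x * y). Proof. exact: (swM Aring). Qed.
Let AX x n : A x -> A (x ^+ n).
Proof. by move=> Ax; elim: n => [|n IH]; rewrite ?expr0 // exprS; apply: AM. Qed.

Let polyA (f : {poly L}) := forall i, A f`_i.

Let polyA_M f g : polyA f -> polyA g -> polyA (f * g).
Proof.
move=> Af Ag i; rewrite coefM; apply: (big_ind A) => // j _; exact: AM.
Qed.

(** The values at [x] of polynomials over [A] form a subring [A[x]] strictly larger than [A], so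
    maximality forces 1/p into it. *)
Let adjoin x : ~ A x -> exists2 f, polyA f & f.[x] = p^-1.
Proof.
move=> nAx; apply: boolp.contrapT => nf; apply: nAx.
pose B z := exists2 f, polyA f & f.[x] = z.
apply: (Amax.2 B).
- split.
  + by exists 1; [move=> i; rewrite coefC; case: ifP|rewrite hornerC].
  + move=> y z [f Af <-] [g Ag <-]; exists (f - g); last by rewrite hornerD hornerN.
    by move=> i; rewrite coefB; apply: (swB Aring).
  + move=> y z [f Af <-] [g Ag <-]; exists (f * g); last by rewrite hornerM.
    exact: polyA_M.
  + by case=> f Af fx; apply: nf; exists f.
- by move=> y Ay; exists y%:P; [move=> i; rewrite coefC; case: ifP|rewrite hornerC].
- by exists 'X; [move=> i; rewrite coefX; case: eqP|rewrite hornerX].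
Qed.

(** All powers of [s = 1 - p * b] are 1 modulo [p A]. If [s^-1] were outside [A], then 1/p would be
    a polynomial in [s^-1]; clearing denominators puts a power of [s] into [p A], hence 1 as well,
    which contradicts that 1/p is not in [A]. *)
Let unit1 b : A b -> 1 - p * b != 0 /\ A (1 - p * b)^-1.
Proof.
move=> Ab; set s := 1 - p * b.
have As : A s by apply: (swB Aring) => //; apply: AM.
have s_pow k : exists2 c, A c & s ^+ k = 1 - p * c.
  elim: k => [|k [c Ac Ec]]; first by exists 0; rewrite // mulr0 subr0.
  exists (b + c - p * b * c).
    by apply: (swB Aring); [apply: AD|do 2![apply: AM => //]].
  by rewrite exprS Ec /s; ring.
have key a k : A a -> s ^+ k = p * a -> False.
  move=> Aa; have [c Ac ->] := s_pow k => E; apply: (swV Aring).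
  suff -> : p^-1 = a + c by apply: AD.
  apply: (mulfI p0); rewrite divff // mulrDr -E; ring.
have s0 : s != 0 by apply/eqP => s0; apply: (key 0 1) => //; rewrite s0; ring.
split=> //; apply: boolp.contrapT => /adjoin [f Af fx].
apply: (key (\sum_(i < size f) f`_i * s ^+ (size f - i)) (size f)).
  by apply: (big_ind A) => // i _; apply: AM => //; apply: AX.
have := congr1 (fun z => p * s ^+ size f * z) fx.
rewrite [_ * p^-1]mulrAC divff // mul1r => <-.
rewrite horner_coef -mulrA mulr_sumr; congr (_ * _); apply: eq_bigr => i _.
rewrite mulrCA; congr (_ * _).
have -> : s ^+ size f = s ^+ (size f - i) * s ^+ i by rewrite -exprD subnK // ltnW.
by rewrite exprVn mulfK ?expf_neq0.
Qed.

(* A relation 1/p = f(x) of degree n >= m is shortened by one of the form 1/p = g(1/x) of degree m. *)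
Let shorten x f g : x != 0 -> polyA f -> polyA g -> (1 < size g <= size f)%N ->
  f.[x] = p^-1 -> g.[x^-1] = p^-1 ->
  exists2 h, polyA h /\ (size h < size f)%N & h.[x] = p^-1.
Proof.
move=> x0 Af Ag mn fx gx; set n := (size f).-1; set m := (size g).-1.
have /andP [m1 mf] := mn.
have sg : size g = m.+1 by rewrite prednK // ltnW.
have sf : size f = n.+1 by rewrite prednK // (leq_trans _ mf) // ltnW.
move: mn; rewrite sg sf !ltnS => /andP [m0 {m1 mf} mn].
have [s0 As] := unit1 (Ag 0%N); set s := 1 - p * g`_0 in s0 As.
have Eg : s = p * \sum_(i < m) g`_i.+1 * x^-1 ^+ i.+1.
  have := congr1 ( *%R p) gx; rewrite horner_coef sg big_ord_recl expr0 mulr1 divff //.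
  by rewrite /s => <-; rewrite mulrDr addrC addrA addNr add0r.
(* Dividing by the unit [s] and multiplying by [x^n] expresses [x^n] through lower powers of [x];
   the exponents [n - i.+1] are true differences because [m <= n]. *)
have Exn : x ^+ n = \sum_(i < m) s^-1 * p * g`_i.+1 * x ^+ (n - i.+1).
  apply: (mulfI s0); rewrite {1}Eg -mulrA mulr_suml !mulr_sumr; apply: eq_bigr => i _.
  have -> : x ^+ n = x ^+ i.+1 * x ^+ (n - i.+1).
    by rewrite -exprD subnKC // (leq_trans (ltn_ord i)).
  have xi : x ^+ i.+1 != 0 by rewrite expf_neq0.
  rewrite exprVn; set y := x ^+ i.+1 in xi *; set z := x ^+ _.
  by field; apply/andP; split.
exists (\sum_(i < n) f`_i *: 'X^i + \sum_(i < m) (f`_n * (s^-1 * p * g`_i.+1)) *: 'X^(n - i.+1)).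
  split.
    move=> k; rewrite coefD !coef_sum; apply: AD; apply: (big_ind A) => // i _;
      rewrite coefZ coefXn.
      by apply: AM => //; case: eqP.
    by apply: AM; [do !apply: AM|case: eqP].
  have n0 : (0 < n)%N by apply: leq_trans mn.
  rewrite ltnS (leq_trans (size_polyD _ _)) // geq_max.
  apply/andP; split; apply: (leq_trans (size_sum _ _ _)); apply/bigmax_leqP => i _;
    apply: (leq_trans (size_scale_leq _ _)); rewrite size_polyXn //.
  by rewrite ltn_subrL.
rewrite hornerD !horner_sum -fx horner_coef sf big_ord_recr /=; congr (_ + _).
  by apply: eq_bigr => i _; rewrite hornerZ hornerXn.
by rewrite Exn mulr_sumr; apply: eq_bigr => i _; rewrite hornerZ hornerXn !mulrA.
Qed.

(** Chevalley's argument: if both [x] and [1/x] were outside [A], there would be relations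
    expressing 1/p in each of them. The longer relation can always be shortened by the other, so the
    total size descends forever. *)
Lemma maximal_without_valuation x : A x \/ A x^-1.
Proof.
apply: boolp.contrapT => /boolp.not_orP [nAx nAx'].
have x0 : x != 0 by apply: contra_notN nAx => /eqP ->.
have [f Af fx] := adjoin nAx; have [g Ag gx] := adjoin nAx'.
have size1 h y : polyA h -> h.[y] = p^-1 -> (1 < size h)%N.
  move=> Ah hy; rewrite ltnNge; apply/negP => /size1_polyC hC.
  by apply: (swV Aring); rewrite -hy hC hornerC.
have [k le_k] := ubnP (size f + size g).
elim: k f g Af Ag fx gx le_k => // k IH f g Af Ag fx gx le_k.
case: (leqP (size g) (size f)) => [le_gf|/ltnW le_fg].
  have [|h [Ah lt_hf] hx] := shorten x0 Af Ag _ fx gx; first by rewrite (size1 g _ Ag gx).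
  by apply: (IH h g) => //; rewrite -ltnS (leq_trans _ le_k) // ltnS ltn_add2r.
have [|||h [Ah lt_hf] hx] := shorten (x := x^-1) _ Ag Af _ gx; rewrite ?invr_eq0 ?invrK //.
  by rewrite (size1 f _ Af fx).
by apply: (IH f h) => //; rewrite -ltnS (leq_trans _ le_k) // ltnS ltn_add2l.
Qed.


End Maximal.
End Chevalley.

(** * The valuation of C_p *)


(** [K] is not ordered, so additivity and multiplicativity of [ratr] are derived from characteristic
    0 by comparing fractions. Recording only existence loses nothing: every morphism from [rat]
    agrees with [ratr] by [fmorph_eq_rat]. *)
Lemma ex_rat_rmorphism (K : fieldType) :
  (forall n : nat, (0 < n)%N -> n%:R != 0 :> K) -> inhabited {rmorphism rat -> K}.
Proof.
move=> charK.
have z0 (z : int) : z != 0 -> z%:~R != 0 :> K.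
  case: z => n zn; first by rewrite -pmulrn charK //; case: n zn.
  by rewrite NegzE mulrNz oppr_eq0 -pmulrn charK.
have E (q : rat) (m n : int) : n != 0 -> q * n%:~R = m%:~R -> ratr q = m%:~R / n%:~R :> K.
  move=> n0 qE; rewrite /ratr; apply/eqP; rewrite eqr_div ?z0 ?denq_neq0 //.
  rewrite -!intrM; apply/eqP; congr _%:~R; apply: (@intr_inj rat).
  by rewrite !intrM numqE -qE; ring.
have E2 (q : rat) : ratr q = (numq q)%:~R / (denq q)%:~R :> K by [].
have dz x : (denq x)%:~R != 0 :> K by rewrite z0 ?denq_neq0.
have ratrB : zmod_morphism (@ratr K).
  move=> x y; rewrite (E _ (numq x * denq y - numq y * denq x) (denq x * denq y)).
  - rewrite (E2 x) (E2 y) !(intrM, intrD, rmorphN, rmorphB) /= !intrM.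
    by field; rewrite !dz.
  - by rewrite mulf_neq0 ?denq_neq0.
  - by rewrite rmorphB /= !intrM !numqE; ring.
have ratrM : monoid_morphism (@ratr K).
  split=> [|x y]; first by rewrite /ratr divr1.
  rewrite (E _ (numq x * numq y) (denq x * denq y)).
  - by rewrite (E2 x) (E2 y) !intrM; field; rewrite !dz.
  - by rewrite mulf_neq0 ?denq_neq0.
  - by rewrite !intrM !numqE; ring.
by constructor; exact: (HB.pack_for {rmorphism rat -> K} (@ratr K)
  (GRing.isZmodMorphism.Build rat K _ ratrB) (GRing.isMonoidMorphism.Build rat K _ ratrM)).
Qed.

Lemma padicv_int p q : is_intq (padicv p q).
Proof. by rewrite /is_intq /padicv !pmulrn -rmorphB /= denq_int. Qed.

Lemma padicv_ge0 p (q : rat) : prime p -> q != 0 -> (0 <= padicv p q) = ~~ (p %| `|denq q|)%N.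
Proof.
move=> p_pr q0; rewrite /padicv subr_ge0 ler_nat.
have nq : (0 < `|numq q|)%N by rewrite absz_gt0 numq_eq0.
have dq : (0 < `|denq q|)%N by rewrite absz_gt0 denq_neq0.
have := coprime_num_den q.
case pd : (p %| `|denq q|)%N => /=.
  move=> co; have pn : ~~ (p %| `|numq q|)%N.
    rewrite -prime_coprime // coprime_sym; apply: coprime_dvdr pd co.
  by rewrite (lognE p `|numq q|) (negbTE pn) !andbF leqNgt logn_gt0 mem_primes p_pr dq pd.
by rewrite (lognE p `|denq q|) pd !andbF.
Qed.

Lemma rat_lt_nat (q : rat) : exists N : nat, q < N%:R.
Proof. by exists (Num.bound `|q|); apply: le_lt_trans (ler_norm q) (archi_boundP (normr_ge0 q)). Qed.

Section ValuedField.
Variables (p : nat) (K : closedFieldType) (v : K -> rat).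
Hypotheses (p_pr : prime p) (HCp : is_Cp p v).
Variable rho : {rmorphism rat -> K}.

Lemma natK_neq0 n : (0 < n)%N -> n%:R != 0 :> K.
Proof. by case: HCp => [[H _] _ _ _ _]; apply: H. Qed.

Lemma pK_neq0 n : p%:R ^+ n != 0 :> K.
Proof. by rewrite expf_neq0 // natK_neq0 // prime_gt0. Qed.

Lemma vM x y : x != 0 -> y != 0 -> v (x * y) = v x + v y.
Proof. by case: HCp => [[_ H] _ _ _ _]; apply: H. Qed.

Lemma v1 : v 1 = 0.
Proof.
by have /eqP := vM (oner_neq0 K) (oner_neq0 K); rewrite mulr1 -subr_eq0 opprD addNKr oppr_eq0 => /eqP.
Qed.

Lemma vV x : x != 0 -> v x^-1 = - v x.
Proof.
move=> x0; apply/eqP; rewrite -subr_eq0 opprK addrC -vM ?invr_eq0 //.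
by rewrite divff // v1.
Qed.

Lemma vN x : v (- x) = v x.
Proof.
have [->|x0] := eqVneq x 0; first by rewrite oppr0.
have N1 : (-1 : K) != 0 by rewrite oppr_eq0 oner_neq0.
suff vN1 : v (-1) = 0 by rewrite -mulN1r vM // vN1 add0r.
by have := vM N1 N1; rewrite mulrNN mulr1 v1 => ?; lra.
Qed.

Lemma vX x n : x != 0 -> v (x ^+ n) = n%:R * v x.
Proof.
move=> x0; elim: n => [|n IH]; first by rewrite expr0 v1 mul0r.
by rewrite exprS vM ?expf_neq0 // IH -add1n natrD mulrDl mul1r.
Qed.

Lemma vD x y : x != 0 -> y != 0 -> x + y != 0 -> Order.min (v x) (v y) <= v (x + y).
Proof. by case: HCp => [_ H _ _ _]; apply: H. Qed.

Lemma val_rat q : q != 0 -> v (rho q) = padicv p q.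
Proof. by rewrite fmorph_eq_rat; case: HCp => [_ _ H _ _]; apply: H. Qed.

Lemma val_p : v p%:R = 1.
Proof.
have p0 : (p%:R : rat) != 0 by rewrite pnatr_eq0 -lt0n prime_gt0.
rewrite -(rmorph_nat rho) val_rat // /padicv; move: p0; rewrite [p%:R]pmulrn => _.
rewrite numq_int denq_int logn1 subr0 /=.
by rewrite -{2}(expn1 p) pfactorK.
Qed.

Lemma val_pX n : v (p%:R ^+ n) = n%:R.
Proof. by rewrite vX ?val_p ?mulr1 // natK_neq0 // prime_gt0. Qed.

Lemma vge_le x d e : e <= d -> vge v x d -> vge v x e.
Proof. by rewrite /vge => ed /orP [->//|dx]; rewrite (le_trans ed dx) orbT. Qed.

Lemma vgeD x y d : vge v x d -> vge v y d -> vge v (x + y) d.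
Proof.
rewrite /vge; have [->|x0] := eqVneq x 0; first by rewrite add0r.
have [->|y0] := eqVneq y 0; first by rewrite addr0 (negbTE x0).
have [//|xy0] := eqVneq (x + y) 0 => /= dx dy.
by apply: le_trans (vD x0 y0 xy0); rewrite le_min dx.
Qed.

Lemma vgeN x d : vge v (- x) d = vge v x d.
Proof. by rewrite /vge oppr_eq0 vN. Qed.

Lemma vgeB x y d : vge v x d -> vge v y d -> vge v (x - y) d.
Proof. by move=> dx dy; apply: vgeD => //; rewrite vgeN. Qed.

Lemma vgeM x y d e : vge v x d -> vge v y e -> vge v (x * y) (d + e).
Proof.
rewrite /vge mulf_eq0; have [//|x0] := eqVneq x 0; have [//|y0] := eqVneq y 0 => /= dx ey.
by rewrite vM // lerD.
Qed.

Lemma vge_divp x n : vge v (x / p%:R ^+ n) 0 = vge v x n%:R.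
Proof.
rewrite /vge mulf_eq0 invr_eq0 (negbTE (pK_neq0 n)) orbF.
have [//|x0 /=] := eqVneq x 0.
by rewrite vM ?invr_eq0 ?pK_neq0 // vV ?pK_neq0 // val_pX subr_ge0.
Qed.

Lemma vge_rat q : vge v (rho q) 0 = ~~ (p %| `|denq q|)%N.
Proof.
rewrite /vge fmorph_eq0; have [->|q0 /=] := eqVneq q 0.
  by rewrite (denq_int 0) dvdn1 gtn_eqF // prime_gt1.
by rewrite val_rat // padicv_ge0.
Qed.

(** Isosceles principle: the strictly smaller of two valuations is the valuation of the sum. *)
Lemma val_near x y d : x != 0 -> v x < d -> vge v (y - x) d -> y != 0 /\ v y = v x.
Proof.
move=> x0 xd yx.
have [y0|y0] := eqVneq y 0.
  by move: yx; rewrite y0 sub0r vgeN /vge (negbTE x0) /= leNgt xd.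
split=> //; apply/eqP; rewrite eq_le; apply/andP; split.
  rewrite leNgt; apply/negP => lt.
  have : vge v (y - (y - x)) (Order.min (v y) d).
    by apply: vgeB; [rewrite /vge ge_min lexx orbT|apply: vge_le yx; rewrite ge_min lexx orbT].
  by rewrite opprB addrC subrK /vge (negbTE x0) /= leNgt lt_min lt xd.
have : vge v ((y - x) + x) (v x).
  by apply: vgeD; [apply: vge_le (ltW xd) yx|rewrite /vge lexx orbT].
by rewrite subrK /vge (negbTE y0).
Qed.

Lemma vge_eq0 x : (forall N : nat, vge v x N%:R) -> x = 0.
Proof.
move=> H; apply/eqP; apply/negPn/negP => x0; have [N lt] := rat_lt_nat (v x).
by have := H N; rewrite /vge (negbTE x0) /= leNgt lt.
Qed.

End ValuedField.

(** * Valuation rings in which p is not invertible *)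


Section ValuationRing.
Variables (p : nat) (L : fieldType) (U : subringClosed L).
Hypothesis p_pr : prime p.
Hypothesis Uval : forall x, x \in U \/ x^-1 \in U.
Hypothesis pNU : p%:R^-1 \notin U.
Implicit Types x y z : L.

(** This is the ideal [p^N U]. It replaces the condition that the valuation is at least [N], since
    the value group of [U] need not embed in the rationals. *)
Definition pdiv_by (N : nat) x := x / p%:R ^+ N \in U.
(** For a valuation ring this is the maximal ideal: membership in [U] is then automatic, as
    [nonunitU] shows. *)
Definition nonunit x := (x == 0) || (x^-1 \notin U).
Local Notation D := pdiv_by.
Local Notation mx := nonunit.

Lemma pL_neq0 : p%:R != 0 :> L.
Proof. by apply: contraNneq pNU => ->; rewrite invr0 rpred0. Qed.

Lemma pLX_neq0 n : p%:R ^+ n != 0 :> L.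
Proof. by rewrite expf_neq0 // pL_neq0. Qed.

Lemma pdiv_by0 x : D 0 x = (x \in U).
Proof. by rewrite /D expr0 divr1. Qed.

Lemma pdiv_byD N x y : D N x -> D N y -> D N (x + y).
Proof. by rewrite /D mulrDl; exact: rpredD. Qed.

Lemma pdiv_byN N x : D N (- x) = D N x.
Proof. by rewrite /D mulNr rpredN. Qed.

Lemma pdiv_byB N x y : D N x -> D N y -> D N (x - y).
Proof. by rewrite /D mulrBl; exact: rpredB. Qed.

Lemma pdiv_byM M N x y : D M x -> D N y -> D (M + N) (x * y).
Proof. by move=> Mx Ny; rewrite /D exprD invfM mulrACA rpredM. Qed.

Lemma pdiv_by_Ml N x y : x \in U -> D N y -> D N (x * y).
Proof. by rewrite -pdiv_by0 => x0 Ny; apply: (pdiv_byM x0). Qed.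

Lemma pdiv_by_pX N : D N (p%:R ^+ N).
Proof. by rewrite /D divff ?pLX_neq0 // rpred1. Qed.

Lemma pdiv_by_le M N x : (M <= N)%N -> D N x -> D M x.
Proof.
rewrite /D => /subnK <-; rewrite exprD invfM => Nx.
have -> : x / p%:R ^+ M = p%:R ^+ (N - M) * (x * (p%:R ^- (N - M) * p%:R ^- M)).
  by field; rewrite !pLX_neq0.
by rewrite rpredM // rpredX // rpred_nat.
Qed.

Lemma pdiv_byU N x : D N x -> x \in U.
Proof. by move/(pdiv_by_le (leq0n N)); rewrite pdiv_by0. Qed.

Lemma pdiv_by_divp M N x : D M (x / p%:R ^+ N) = D (N + M) x.
Proof. by rewrite /D exprD invfM mulrA. Qed.

Lemma nonunit1 : ~~ mx 1.
Proof. by rewrite /mx oner_eq0 invr1 rpred1. Qed.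

Lemma unitU x : x \in U -> ~~ mx x -> x != 0 /\ x^-1 \in U.
Proof. by rewrite /mx negb_or negbK => _ /andP. Qed.

Lemma notU_nonunit x : x \notin U -> mx x^-1.
Proof. by move=> xU; rewrite /mx invrK xU orbT. Qed.

Lemma nonunitU x : mx x -> x \in U.
Proof.
rewrite /mx => /orP [/eqP ->|xV]; first exact: rpred0.
by case: (Uval x) => // xV'; rewrite xV' in xV.
Qed.

Lemma nonunitN x : mx (- x) = mx x.
Proof. by rewrite /mx oppr_eq0 invrN rpredN. Qed.

Lemma nonunitM x y : x \in U -> mx y -> mx (x * y).
Proof.
move=> xU; rewrite /mx mulf_eq0; have [//|x0] := eqVneq x 0.
have [//|y0 /=] := eqVneq y 0; apply: contra => xyU.
by have -> : y^-1 = x * (x * y)^-1; [field; apply/andP|rewrite rpredM].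
Qed.

(** Of two nonzero elements one divides the other in [U], so the sum is a multiple of one of
    them. *)
Lemma nonunitD x y : mx x -> mx y -> mx (x + y).
Proof.
have [->|x0] := eqVneq x 0; first by rewrite add0r.
have [->|y0] := eqVneq y 0; first by rewrite addr0.
wlog xy : x y x0 y0 / x / y \in U => [W mxx my|_ my].
  case: (Uval (x / y)) => [xy|]; first exact: W.
  by rewrite invf_div addrC => yx; apply: W.
rewrite (_ : x + y = (x / y + 1) * y); last by field.
by apply: nonunitM => //; rewrite rpredD // rpred1.
Qed.

Lemma nonunit_prime x y : x \in U -> y \in U -> mx (x * y) -> mx x \/ mx y.
Proof.
move=> xU yU mxy; case mxx: (mx x); first by left.
right; have [x0 xVU] := unitU xU (negbT mxx).
by rewrite -(mulKf x0 y); apply: nonunitM.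
Qed.

Lemma nonunit_prod (I : eqType) (r : seq I) (F : I -> L) :
  {in r, forall i, F i \in U} -> mx (\prod_(i <- r) F i) -> exists2 i, i \in r & mx (F i).
Proof.
elim: r => [|i r IH] FU; first by rewrite big_nil (negbTE nonunit1).
have rU : {in r, forall j, F j \in U} by move=> j jr; apply: FU; rewrite inE jr orbT.
rewrite big_cons => /nonunit_prime [||mi|/IH [] // j jr mj].
- by apply: FU; rewrite mem_head.
- by rewrite big_seq rpred_prod.
- by exists i; rewrite ?mem_head.
- by exists j; rewrite // inE jr orbT.
Qed.

Lemma nonunitX x n : x \in U -> mx (x ^+ n) -> mx x.
Proof.
move=> xU; elim: n => [|n IH]; first by rewrite expr0 (negbTE nonunit1).
by rewrite exprS => /nonunit_prime [] //; apply: rpredX.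
Qed.

Lemma nonunit_p : mx p%:R.
Proof. by rewrite /mx pNU orbT. Qed.

Lemma pdiv_by_nonunit x : D 1 x -> mx x.
Proof. by rewrite /D expr1 -{2}(divfK pL_neq0 x) => xU; apply: nonunitM nonunit_p. Qed.

Lemma unit1D x : x \in U -> mx x -> (1 + x)^-1 \in U /\ 1 + x != 0.
Proof.
move=> xU mxx; case: (@unitU (1 + x)); rewrite ?rpredD ?rpred1 //.
apply: contra nonunit1 => m1x; rewrite -(addrK x 1); apply: nonunitD => //.
by rewrite nonunitN.
Qed.

(** First-order Taylor expansion of a power about [y]. It serves with exponent [p^d], where the
    linear coefficient is divisible by [p]. *)
Lemma expr_taylor2 n x y : x \in U -> y \in U -> exists2 r, r \in U &
  x ^+ n.+1 = y ^+ n.+1 + n.+1%:R * y ^+ n * (x - y) + (x - y) ^+ 2 * r.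
Proof.
move=> xU yU; elim: n => [|n [r rU E]]; first by exists 0; rewrite ?rpred0 //; ring.
exists (x * r + n.+1%:R * y ^+ n).
  by rewrite rpredD ?rpredM ?rpred_nat ?rpredX.
rewrite (exprS x) E (exprS y n.+1) (mulrS 1 n.+1) (exprS y n).
by move: (n.+1%:R : L) => c; ring.
Qed.

(** If [tau] were outside [U], then [tau^-1] would be a nonunit one of whose powers is 1. *)
Lemma Teichmuller_integral d tau : (0 < d)%N -> tau ^+ (p ^ d) = tau -> tau \in U.
Proof.
move=> d0 tauE; apply/negPn/negP => tauU.
have tau0 : tau != 0 by apply: contraNneq tauU => ->; rewrite rpred0.
have tVU : tau^-1 \in U by case: (Uval tau) => // tU; rewrite tU in tauU.
have [n qE] : exists n, (p ^ d = n.+2)%N.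
  have : (1 < p ^ d)%N by rewrite -(exp1n d) ltn_exp2r // prime_gt1.
  by case: (p ^ d)%N => [|[|n]] // _; exists n.
have E : tau^-1 ^+ n * tau^-1 = 1.
  rewrite -exprSr exprVn (_ : tau ^+ n.+1 = 1) ?invr1 //.
  by apply: (mulIf tau0); rewrite -exprSr -qE tauE mul1r.
by have := nonunit1; rewrite -E nonunitM ?rpredX // notU_nonunit.
Qed.

Section Teichmuller.
Variables (d : nat) (tau z : L).
Hypotheses (d0 : (0 < d)%N) (tauE : tau ^+ (p ^ d) = tau).
Hypotheses (tauU : tau \in U) (zU : z \in U).

Let q_succ : exists n, (p ^ d = n.+1)%N.
Proof. by exists (p ^ d).-1; rewrite prednK // expn_gt0 prime_gt0. Qed.

Let q_pdiv : D 1 (p ^ d)%:R.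
Proof.
by rewrite /D expr1 -(prednK d0) expnS natrM mulrC mulKf ?pL_neq0 // rpred_nat.
Qed.

(** Put [h = z - tau] and q = [p^d]. By the Taylor expansion [z^q - z] is [-h] times 1 minus a
    nonunit, because [p] divides q and [h] is a nonunit. That factor is a unit, so [h] is divisible
    by [p] along with [z^q - z]. *)
Lemma Teichmuller_pdiv : mx (z - tau) -> D 1 (z ^+ (p ^ d) - z) -> D 1 (z - tau).
Proof.
move=> myt; have [n qE] := q_succ; have [r rU E] := expr_taylor2 n zU tauU.
rewrite qE E; set h := z - tau in myt *.
have hU : h \in U by rewrite rpredB.
rewrite -qE tauE [X in D 1 X](_ : _ = h * - (1 + - ((p ^ d)%:R * tau ^+ n + h * r))); last first.
  by rewrite /h; ring.
set e := - (_ * _ + _) => De; have eU : e \in U by rewrite rpredN rpredD ?rpredM ?rpred_nat ?rpredX.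
case: (@unit1D e) => //.
  rewrite nonunitN; apply: nonunitD; last by rewrite mulrC nonunitM.
  by rewrite mulrC nonunitM ?rpredX //; apply: pdiv_by_nonunit.
move=> uU u0; rewrite -(mulfK u0 h) mulrC; apply: pdiv_by_Ml => //.
by rewrite -pdiv_byN -mulrN.
Qed.

(** Raising to the power q = [p^d] fixes [tau] and multiplies the difference [h] by
    [q * tau^(q-1) + h * r], which is divisible by [p]. Hence [tau] is the p-adic limit of iterated
    powers of [z]. *)
Lemma Teichmuller_lim k : D 1 (z - tau) -> D k.+1 (z ^+ ((p ^ d) ^ k) - tau).
Proof.
move=> D1; elim: k => [|k IH]; first by rewrite expn0 expr1.
rewrite expnSr exprM; set y := z ^+ _ in IH *; have yU : y \in U by rewrite rpredX.
have [n qE] := q_succ; have [r rU E] := expr_taylor2 n yU tauU.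
rewrite qE E -qE tauE; set h := y - tau in IH *.
rewrite [X in D _ X](_ : _ = ((p ^ d)%:R * tau ^+ n + h * r) * h); last by ring.
rewrite -add1n; apply: pdiv_byM => //.
apply: pdiv_byD; rewrite mulrC; apply: pdiv_by_Ml; rewrite ?rpredX //.
by apply: pdiv_by_le IH.
Qed.

End Teichmuller.
End ValuationRing.

(** * Teichmuller representatives *)


(** The partial sums of p-adic expansions with Teichmuller digits. The exponent [d] may change from
    digit to digit, so the residues of the digits are not confined to one finite field. *)
Inductive Teichmuller_sum (p : nat) (K : fieldType) : nat -> K -> Prop :=
| Tsum0 : Teichmuller_sum p 0 0
| TsumS n b d tau : (0 < d)%N -> tau ^+ (p ^ d) = tau ->
    Teichmuller_sum p n b -> Teichmuller_sum p n.+1 (b + p%:R ^+ n * tau).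

Lemma exprB_pchar_pow (R : comNzRingType) p n (x y : R) : p \in [pchar R] ->
  (x - y) ^+ (p ^ n) = x ^+ (p ^ n) - y ^+ (p ^ n).
Proof.
move=> pR; elim: n => [|n IH]; first by rewrite expn0 !expr1.
rewrite expnSr !exprM IH.
by have := pFrobenius_autB_comm pR (mulrC (x ^+ (p ^ n)) (y ^+ (p ^ n))).
Qed.

(** Pigeonhole: there are finitely many residues modulo [g], so [X^(p^i)] and [X^(p^j)] agree for
    some [i < j], and their difference is [(X^(p^(j-i)) - X)^(p^i)] in characteristic [p]. *)
Lemma dvdp_exp_XnsubX p (g : {poly 'F_p}) : prime p -> g != 0 ->
  exists d e, (0 < d)%N /\ g %| ('X^(p ^ d) - 'X) ^+ (p ^ e).
Proof.
move=> p_pr g0.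
pose f (i : nat) : 'rV['F_p]_(size g) := poly_rV ('X^(p ^ i) %% g).
pose N := #|{: 'rV['F_p]_(size g)}|.
have /injectivePn [i [j]] : ~~ injectiveb (fun i : 'I_N.+1 => f i).
  apply/negP => /injectiveP /leq_card; rewrite card_ord -/N => H.
  by have := leq_ltn_trans H (ltnSn _); rewrite ltnn.
wlog ij : i j / (i < j)%N => [W ne ef|_ ef].
  have [lt|lt|/val_inj eq] := ltngtP i j; first exact: (W i j).
    by apply: (W j i) => //; rewrite eq_sym.
  by rewrite eq eqxx in ne.
exists (j - i)%N, i; split; first by rewrite subn_gt0.
rewrite exprB_pchar_pow; last by rewrite pchar_poly pchar_Fp.
rewrite -exprM -expnD subnK ?(ltnW ij) //.
have szr k : is_true (leq (size ('X^(p ^ k) %% g)) (size g)) by rewrite ltnW // ltn_modp.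
have /(congr1 rVpoly) := ef; rewrite !poly_rV_K // => emod.
by rewrite (divp_eq 'X^(p ^ j) g) (divp_eq 'X^(p ^ i) g) emod opprD addrACA subrr addr0 -mulrBl dvdp_mull.
Qed.

Section Residue.
Variables (p : nat) (K : closedFieldType) (v : K -> rat).
Hypotheses (p_pr : prime p) (HCp : is_Cp p v).
Variables (L : fieldType) (U : subringClosed L).
Hypothesis Uval : forall x, x \in U \/ x^-1 \in U.
Hypothesis pNU : p%:R^-1 \notin U.
Variable kap : {rmorphism K -> L}.
Hypothesis kapU : forall x, (kap x \in U) = vge v x 0.
Variable rho : {rmorphism rat -> K}.
Local Notation D := (pdiv_by p U).
Local Notation mx := (nonunit U).

Lemma pdiv_by_kap N x : D N (kap x) = vge v x N%:R.
Proof. by rewrite -(vge_divp p_pr HCp) // -kapU /pdiv_by rmorphM fmorphV rmorphXn rmorph_nat. Qed.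

Lemma pdiv_by_horner_int (F : {poly int}) x : kap x \in U ->
  (forall i, (p %| F`_i)%Z) -> D 1 (kap (map_poly intr F).[x]).
Proof.
move=> xU pF; rewrite horner_coef rmorph_sum /=.
apply: (big_ind (fun y => D 1 y)) => [||i _]; first by rewrite /pdiv_by mul0r rpred0.
  exact: pdiv_byD.
rewrite coef_map /=; have /dvdzP [c ->] := pF i.
rewrite !rmorphM rmorphXn mulrAC; apply: pdiv_by_Ml.
  by rewrite rpredM ?rpredX // rmorph_int rpred_int.
by rewrite rmorph_int -pmulrn -(expr1 p%:R); apply: pdiv_by_pX.
Qed.

(** The residue field of [K] is algebraic over [F_p]: modulo [p], [r] equals some [y] algebraic over
    Q, and [y] is a root of a primitive integral polynomial [G]. Modulo [p], [G] is nonzero and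
    divides a power of some [X^(p^d) - X]. *)
Lemma residue_algebraic r : vge v r 0 ->
  exists2 d, (0 < d)%N & mx (kap (r ^+ (p ^ d) - r)).
Proof.
move=> r0.
have [y [[P [P0 Py]] ry]] : exists y : K, alg_over_Q y /\ vge v (r - y) 1%:R.
  by case: HCp => [_ _ _ _ H]; apply: H.
have ry' : D 1 (kap (r - y)) by rewrite pdiv_by_kap.
have yU : kap y \in U.
  rewrite -(subKr r y) rmorphB; apply: rpredB; [by rewrite kapU|exact: (pdiv_byU pNU ry')].
have [Q [a a0 PE]] := rat_poly_scale P.
have Q0 : Q != 0 by apply: contraNneq P0 => Q0; rewrite PE Q0 rmorph0 scaler0.
pose G := zprimitive Q.
have Gy : (map_poly intr G).[y] = 0 :> K.
  have : root (map_poly rho P) y by rewrite (eq_map_poly (fmorph_eq_rat rho)).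
  rewrite PE (zpolyEprim Q) -/G !map_polyZ /= rootZ ?fmorph_eq0 ?invr_eq0 ?intr_eq0 //.
  rewrite rootZ ?fmorph_eq0 ?intr_eq0 ?zcontents_eq0 // -map_poly_comp.
  by rewrite (eq_map_poly (g := intr)) => [/eqP|z /=]; rewrite ?rmorph_int.
have G0 : map_poly intr G != 0 :> {poly 'F_p}.
  apply/negP => /eqP G0.
  have : (p %| zcontents G)%Z.
    rewrite dvdz_contents; apply/polyOverP => i.
    by rewrite [_ \in _](dvdz_pcharf (pchar_Fp p_pr)) -coef_map G0 coef0.
  by rewrite zcontents_primitive Q0 dvdz1 /= gtn_eqF // prime_gt1.
have [d [e [d0 /dvdpP [h hE]]]] := dvdp_exp_XnsubX p_pr G0.
exists d => //.
pose H : {poly int} := map_poly (fun c : 'F_p => (c : nat)%:Z) h.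
have HE : map_poly intr H = h.
  apply/polyP => i; rewrite coef_map /= coef_map_id0 //.
  by rewrite -pmulrn natr_Zp.
(* [H] lifts the cofactor of [G], so all coefficients of [F] are divisible by [p]. Since [G]
   vanishes at [y], the value of [F] there is the power of [y^(p^d) - y] alone. *)
pose F : {poly int} := ('X^(p ^ d) - 'X) ^+ (p ^ e) - H * G.
have pF i : (p %| F`_i)%Z.
  rewrite (dvdz_pcharf (pchar_Fp p_pr)) -coef_map /=.
  by rewrite rmorphB rmorphM rmorphXn rmorphB /= map_polyX map_polyXn HE hE subrr coef0.
have := pdiv_by_horner_int yU pF.
rewrite rmorphB rmorphM rmorphXn rmorphB /= map_polyX map_polyXn.
rewrite hornerD hornerN hornerM Gy mulr0 subr0 horner_exp !hornerE rmorphXn /=.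
move=> /(pdiv_by_nonunit pNU) /nonunitX mxy.
have {}mxy : mx (kap (y ^+ (p ^ d) - y)).
  by apply: mxy; rewrite rmorphB rmorphXn rpredB ?rpredX.
rewrite (_ : r ^+ (p ^ d) - r = (y ^+ (p ^ d) - y) + ((r ^+ (p ^ d) - y ^+ (p ^ d)) - (r - y))); last by ring.
rewrite rmorphD; apply: nonunitD => //; apply: (pdiv_by_nonunit pNU).
rewrite rmorphB; apply: pdiv_byB => //; rewrite subrXX mulrC rmorphM; apply: pdiv_by_Ml => //.
rewrite rmorph_sum rpred_sum // => i _.
by rewrite rmorphM !rmorphXn rpredM ?rpredX // kapU.
Qed.

(** [X^(p^d) - X] splits over [K], so the nonunit [r^(p^d) - r] is the product of the [r - tau] over
    its roots, and the maximal ideal is prime. *)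
Lemma ex_Teichmuller r : vge v r 0 ->
  exists d tau, [/\ (0 < d)%N, tau ^+ (p ^ d) = tau & mx (kap (r - tau))].
Proof.
move=> r0; have [d d0 mr] := residue_algebraic r0.
have q1 : (1 < p ^ d)%N by rewrite -(exp1n d) ltn_exp2r // prime_gt1.
have sP : size ('X^(p ^ d) - 'X : {poly K}) = (p ^ d).+1.
  by rewrite size_polyDl size_polyXn // size_polyN size_polyX.
have [s sE] := closed_field_poly_normal ('X^(p ^ d) - 'X : {poly K}).
have lc : lead_coef ('X^(p ^ d) - 'X : {poly K}) = 1.
  by rewrite lead_coefE sP /= coefB coefXn coefX eqxx gtn_eqF // subr0.
rewrite lc scale1r in sE.
have root_s tau : tau \in s -> tau ^+ (p ^ d) = tau.
  move=> ts; have : root ('X^(p ^ d) - 'X) tau by rewrite sE root_prod_XsubC.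
  by rewrite /root !hornerE subr_eq0 => /eqP.
have mprod : mx (\prod_(tau <- s) kap (r - tau)).
  rewrite -rmorph_prod; have := congr1 (fun P => P.[r]) sE.
  rewrite horner_prod !hornerE => E.
  by under eq_bigr do rewrite -hornerXsubC; rewrite -E.
have [|tau ts mt] := nonunit_prod _ mprod.
  move=> tau /root_s tauE; rewrite rmorphB rpredB ?kapU // -kapU.
  by apply: (Teichmuller_integral p_pr Uval d0); rewrite -rmorphXn tauE.
by exists d, tau; split=> //; apply: root_s.
Qed.
End Residue.

(** * The field Q_p *)


Section Qp.
Variables (p : nat) (K : closedFieldType) (v : K -> rat).
Hypotheses (p_pr : prime p) (HCp : is_Cp p v).
Variable rho : {rmorphism rat -> K}.
Implicit Types (x y : K).

Lemma vge_bound x : exists k : nat, vge v x (- k%:R).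
Proof.
have [k lt_k] := rat_lt_nat (- v x); exists k; rewrite /vge.
by rewrite lerNl (ltW lt_k) orbT.
Qed.

Lemma vge_mul_bound k x y d : vge v x (- k%:R) -> vge v y (d + k%:R) -> vge v (x * y) d.
Proof. by move=> kx dy; have := vgeM HCp kx dy; apply: vge_le; rewrite addrC addrK. Qed.

Lemma inQpE x : inQp v x <-> forall N : nat, exists q, vge v (x - rho q) N%:R.
Proof. by split=> H N; have [q Hq] := H N; exists q; move: Hq; rewrite (fmorph_eq_rat rho q). Qed.

Lemma inQp_rat q : inQp v (rho q).
Proof. by apply/inQpE => N; exists q; rewrite subrr /vge eqxx. Qed.

Lemma inQp0 : inQp v 0. Proof. by rewrite -(rmorph0 rho); apply: inQp_rat. Qed.
Lemma inQp1 : inQp v 1. Proof. by rewrite -(rmorph1 rho); apply: inQp_rat. Qed.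

Lemma inQp_lim x : (forall N : nat, exists2 y, inQp v y & vge v (x - y) N%:R) -> inQp v x.
Proof.
move=> H N; have [y Qy xy] := H N; have [q yq] := Qy N; exists q.
by rewrite -(subrK y x) -addrA; apply: (vgeD HCp).
Qed.

Lemma inQpD x y : inQp v x -> inQp v y -> inQp v (x + y).
Proof.
move=> /inQpE Qx /inQpE Qy; apply/inQpE => N.
have [[q Hq] [r Hr]] := (Qx N, Qy N); exists (q + r).
by rewrite rmorphD opprD addrACA; apply: (vgeD HCp).
Qed.

Lemma inQpM x y : inQp v x -> inQp v y -> inQp v (x * y).
Proof.
move=> /inQpE Qx /inQpE Qy; apply/inQpE => N.
have [k kx] := vge_bound x; have [r Hr] := Qy (N + k)%N.
have [l lr] := vge_bound (rho r); have [q Hq] := Qx (N + l)%N.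
rewrite !natrD in Hr Hq; exists (q * r).
rewrite rmorphM (_ : _ - _ = x * (y - rho r) + rho r * (x - rho q)); last by ring.
by apply: (vgeD HCp) => //; [apply: vge_mul_bound kx Hr|apply: vge_mul_bound lr Hq].
Qed.

Lemma inQpN x : inQp v x -> inQp v (- x).
Proof. by rewrite -mulN1r -(rmorph1 rho) -rmorphN; apply: inQpM; apply: inQp_rat. Qed.

Lemma inQpB x y : inQp v x -> inQp v y -> inQp v (x - y).
Proof. by move=> Qx Qy; apply: inQpD => //; apply: inQpN. Qed.

Lemma inQp_inv x : inQp v x -> inQp v x^-1.
Proof.
have [->|x0] := eqVneq x 0; first by rewrite invr0.
move=> /inQpE Qx; apply/inQpE => N.
(* The difference of inverses is [(rho q - x) / (x * rho q)]. Once [rho q] has the valuation of [x],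
   inversion costs at most twice the absolute value of [v x] in precision. *)
have [k lt_k] := rat_lt_nat (`|v x| *+ 2).
have [q Hq] := Qx (N + k)%N; have := Hq; rewrite -(vgeN HCp) opprB => Hq'.
have [|q0 vq] := val_near HCp x0 _ Hq'.
  rewrite natrD; have := ler_norm (v x); have : 0 <= N%:R :> rat by rewrite ler0n.
  have := normr_ge0 (v x); lra.
exists q^-1; rewrite fmorphV.
have -> : x^-1 - (rho q)^-1 = (x * rho q)^-1 * (rho q - x) by field; rewrite q0.
apply: (@vge_mul_bound k); last by rewrite -natrD.
rewrite /vge invr_eq0 mulf_eq0 (negbTE x0) (negbTE q0) /=.
rewrite (vV HCp) ?mulf_neq0 // (vM HCp) // vq lerN2.
by have := ler_norm (v x); move: lt_k; lra.
Qed.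

Lemma inQp_sum (I : Type) (r : seq I) (P : pred I) F :
  (forall i, P i -> inQp v (F i)) -> inQp v (\sum_(i <- r | P i) F i).
Proof. by move=> H; apply: big_ind => //; [apply: inQp0|apply: inQpD]. Qed.

Lemma polyQp_ops :
  [/\ polyQp v 1, (forall f g, polyQp v f -> polyQp v g -> polyQp v (f + g)) ,
      (forall f, polyQp v f -> polyQp v (- f)) & 
      (forall f g, polyQp v f -> polyQp v g -> polyQp v (f * g))].
Proof.
split=> [i|f g Qf Qg i|f Qf i|f g Qf Qg i].
- by rewrite coefC; case: ifP => _; [apply: inQp1|apply: inQp0].
- by rewrite coefD; apply: inQpD.
- by rewrite coefN; apply: inQpN.
- by rewrite coefM; apply: inQp_sum => j _; apply: inQpM.
Qed.

Lemma polyQpC c : inQp v c -> polyQp v c%:P.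
Proof. by move=> Qc i; rewrite coefC; case: ifP => // _; apply: inQp0. Qed.

Lemma polyQpX n : polyQp v 'X^n.
Proof. by move=> i; rewrite coefXn; case: eqP => _; [apply: inQp1|apply: inQp0]. Qed.

Lemma polyQp_rat f : polyQp v (map_poly rho f).
Proof. by move=> i; rewrite coef_map; apply: inQp_rat. Qed.

Lemma Teichmuller_sum_algebraic n a : Teichmuller_sum p n a -> algebraicOver rho a.
Proof.
elim=> [|{}n b d tau d0 tauE _ IH]; first exact: algebraic0.
apply: algebraic_add => //; apply: algebraic_mul.
  by rewrite -(rmorph_nat rho) -rmorphXn; apply: algebraic_id.
have q1 : (1 < p ^ d)%N by rewrite -(exp1n d) ltn_exp2r // prime_gt1.
exists ('X^(p ^ d) - 'X).
  by rewrite -size_poly_gt0 size_polyDl ?size_polyXn // size_polyN size_polyX ltnS.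
by rewrite rmorphB /= map_polyXn map_polyX /root !hornerE tauE subrr.
Qed.

Lemma algebraic_alg_Qp a : algebraicOver rho a -> alg_Qp v a.
Proof.
move=> [f f0 fa]; exists (map_poly rho f); rewrite map_poly_eq0; split=> //; split=> //.
exact: polyQp_rat.
Qed.

End Qp.

(** * Minimality of finite Teichmuller sums *)


Section QpSpan.
Variables (p : nat) (K : closedFieldType) (v : K -> rat).
Hypotheses (p_pr : prime p) (HCp : is_Cp p v).
Variable rho : {rmorphism rat -> K}.
Implicit Types (x y e b c : K) (V : K -> Prop).

Definition v_closed V := forall x, (forall N : nat, exists2 y, V y & vge v (x - y) N%:R) -> V x.

Record Qp_subspace V : Prop := QpSubspace {
  subspace0 : V 0;
  subspaceB : forall x y, V x -> V y -> V (x - y);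
  subspaceZ : forall c x, inQp v c -> V x -> V (c * x) }.

Lemma subspaceD V x y : Qp_subspace V -> V x -> V y -> V (x + y).
Proof.
move=> HV Vx Vy; rewrite -(opprK y); apply: (subspaceB HV) => //.
by rewrite -sub0r; apply: (subspaceB HV) => //; apply: (subspace0 HV).
Qed.

Definition add_line V e x := exists2 c, inQp v c & V (x - c * e).

Lemma add_line_subspace V e : Qp_subspace V -> Qp_subspace (add_line V e).
Proof.
move=> HV; split.
- by exists 0; [apply: (inQp0 v rho)|rewrite mul0r subr0; apply: (subspace0 HV)].
- move=> x y [c Qc Vx] [d Qd Vy]; exists (c - d); first exact: (inQpB HCp rho).
  rewrite (_ : _ - _ = (x - c * e) - (y - d * e)); last by ring.
  exact: (subspaceB HV).
- move=> c x Qc [d Qd Vx]; exists (c * d); first exact: (inQpM HCp rho).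
  by rewrite -mulrA -mulrBr; apply: (subspaceZ HV).
Qed.

(** If [e] is outside the closed [V], its distance to [V] is positive, so a small vector of
    [V + Q_p e] has a small coefficient at [e]. The coefficients of converging approximations are
    thus Cauchy, and completeness supplies the limit coefficient. *)
Lemma add_line_closed V e : Qp_subspace V -> v_closed V -> v_closed (add_line V e).
Proof.
move=> HV clV x Hx.
have [Ve|nVe] := boolp.EM (V e).
  have Vx : V x.
    apply: clV => N; have [y [c Qc Vy] xy] := Hx N; exists y => //.
    by rewrite -(subrK (c * e) y); apply: (subspaceD HV) => //; apply: (subspaceZ HV).
  by exists 0; [apply: (inQp0 v rho)|rewrite mul0r subr0].
have [M HM] : exists M : nat, forall y, V y -> ~~ vge v (e - y) M%:R.
  apply: boolp.contrapT => nM; apply: nVe; apply: clV => N.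
  apply: boolp.contrapT => nN; apply: nM; exists N => y Vy.
  by apply/negP => H; apply: nN; exists y.
have /boolp.choice [c Hc] : forall N, exists c, inQp v c /\
    exists2 y, V y & vge v (x - (y + c * e)) N%:R.
  move=> N; have [y [c Qc Vy] xy] := Hx N; exists c; split=> //.
  by exists (y - c * e); rewrite ?subrK.
have c_near N m n : (N + M <= m)%N -> (N + M <= n)%N -> vge v (c m - c n) N%:R.
  move=> Nm Nn; have [Qm [y Vy xy]] := Hc m; have [Qn [z Vz xz]] := Hc n.
  have le_vge k u : (N + M <= k)%N -> vge v u k%:R -> vge v u (N + M)%:R.
    by move=> Nk; apply: vge_le; rewrite ler_nat.
  have := vgeB HCp (le_vge _ _ Nn xz) (le_vge _ _ Nm xy).
  set d := c m - c n; rewrite (_ : _ - _ = d * e + (y - z)); last by rewrite /d; ring.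
  rewrite /vge; have [//|d0 /=] := eqVneq d 0.
  (* Dividing the small vector [d * e + (y - z)] by [d] compares [e] with an element of [V]; the
     bound [M] then transfers the smallness to [d]. *)
  have Qd : inQp v d^-1 by apply: (inQp_inv HCp rho); apply: (inQpB HCp rho).
  have Vw : V (- (d^-1 * (y - z))).
    by rewrite -mulrN opprB; apply: (subspaceZ HV) => //; apply: (subspaceB HV).
  have := HM _ Vw; rewrite opprK (_ : d * e + _ = d * (e + d^-1 * (y - z))); last by field.
  set w := e + _; rewrite /vge mulf_eq0 (negbTE d0) negb_or -ltNge => /andP [w0 lt_w] /=.
  by rewrite (negbTE w0) (vM HCp) // natrD /= => ?; lra.
have [l Hl] : exists l, forall N : nat, exists k, forall n, (k <= n)%N -> vge v (c n - l) N%:R.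
  by case: HCp => [_ _ _ H _]; apply: H => N; exists (N + M)%N => m n; apply: c_near.
exists l.
  apply: (inQp_lim HCp) => N; have [k Hk] := Hl N; exists (c k); first by have [] := Hc k.
  by rewrite -(vgeN HCp) opprB; apply: Hk.
apply: clV => N; have [k ek] := vge_bound v e; have [m Hm] := Hl (N + k)%N.
have [_ [y Vy xy]] := Hc (maxn m N); exists y => //.
rewrite (_ : _ - y = (x - (y + c (maxn m N) * e)) + e * (c (maxn m N) - l)); last by ring.
apply: (vgeD HCp); first by apply: vge_le xy; rewrite ler_nat leq_maxr.
by apply: (vge_mul_bound HCp ek); rewrite -natrD; apply: Hm; rewrite leq_maxl.
Qed.

(** The Q_p-span of the first [n] powers of [b], built one line at a time so that closedness passes
    up by induction. Once it contains [b^n] it is the ring [Q_p[b]]. *)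
Fixpoint power_span b n : K -> Prop :=
  if n is m.+1 then add_line (power_span b m) (b ^+ m) else eq^~ 0.

Lemma power_span_subspace b n : Qp_subspace (power_span b n).
Proof.
elim: n => [|n IH]; last exact: add_line_subspace.
by split=> //= [x y -> ->|c x _ ->]; rewrite ?subr0 ?mulr0.
Qed.

Lemma power_span_closed b n : v_closed (power_span b n).
Proof.
elim: n => [|n IH]; last by apply: add_line_closed => //; apply: power_span_subspace.
move=> x Hx; apply: (@vge_eq0 K v) => N; have [y -> ] := Hx N.
by rewrite subr0.
Qed.

Lemma power_spanP b n x : power_span b n x ->
  exists2 c : nat -> K, forall j, inQp v (c j) & x = \sum_(j < n) c j * b ^+ j.
Proof.
elim: n x => [|n IH] x /=; first by move=> ->; exists (fun=> 0) => [j|]; rewrite ?big_ord0 //; apply: (inQp0 v rho).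
case=> c Qc /IH [d Qd E]; exists (fun j => if j == n then c else d j) => [j|]; first by case: eqP.
rewrite big_ord_recr /= eqxx -(subrK (c * b ^+ n) x) E; congr (_ + _).
by apply: eq_bigr => i _; rewrite ltn_eqF.
Qed.

Lemma power_span_le b m n x : (m <= n)%N -> power_span b m x -> power_span b n x.
Proof.
move=> /subnK <-; elim: (n - m)%N => // k IH Hx; rewrite addSn /=.
by exists 0; [apply: (inQp0 v rho)|rewrite mul0r subr0; apply: IH].
Qed.

Lemma power_span_exp b n : power_span b n.+1 (b ^+ n).
Proof.
exists 1; first exact: (inQp1 v rho).
by rewrite mul1r subrr; apply: (subspace0 (power_span_subspace b n)).
Qed.

Section Ring.
Variables (b : K) (n : nat).
Hypotheses (n0 : (0 < n)%N) (bn : power_span b n (b ^+ n)).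
Local Notation B := (power_span b n).
Let HB := power_span_subspace b n.

Lemma power_span1 : B 1.
Proof. by rewrite -(expr0 b); apply: (power_span_le n0); apply: power_span_exp. Qed.

Lemma power_span_mulb x : B x -> B (b * x).
Proof.
suff H k : (k <= n)%N -> forall y, power_span b k y -> B (b * y) by apply: H.
elim: k => [|k IH] lt_kn y /=; first by move=> ->; rewrite mulr0; apply: (subspace0 HB).
case=> c Qc /(IH (ltnW lt_kn)) By.
rewrite (_ : b * y = b * (y - c * b ^+ k) + c * b ^+ k.+1); last by rewrite exprS; ring.
apply: (subspaceD HB) => //; apply: (subspaceZ HB) => //.
move: lt_kn; rewrite leq_eqVlt => /orP [/eqP ->//|lt_kn].
by apply: (power_span_le lt_kn); apply: power_span_exp.
Qed.

Lemma power_spanM x y : B x -> B y -> B (x * y).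
Proof.
move=> Bx By; move: x Bx.
suff H k : forall x, power_span b k x -> B (x * y) by exact: H.
elim: k => [|k IH] x /=; first by move=> ->; rewrite mul0r; apply: (subspace0 HB).
case=> c Qc /IH Bx.
rewrite (_ : x * y = (x - c * b ^+ k) * y + c * (b ^+ k * y)); last by ring.
apply: (subspaceD HB) => //; apply: (subspaceZ HB) => //.
elim: k {IH Bx} => [|k IH]; first by rewrite expr0 mul1r.
by rewrite exprS -mulrA; apply: power_span_mulb.
Qed.

Lemma power_spanX x k : B x -> B (x ^+ k).
Proof.
move=> Bx; elim: k => [|k IH]; first exact: power_span1.
by rewrite exprS; apply: power_spanM.
Qed.

Lemma power_span_b : B b.
Proof. by have := power_span_mulb power_span1; rewrite mulr1. Qed.

(** Multiplication by [a] acts on the powers of [b] through a matrix over Q_p. The row of powers is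
    an eigenvector for [a], nonzero because its first entry is 1, so [a] is a root of the
    characteristic polynomial of degree [n]. The powers may be dependent. *)
Lemma power_span_deg a : B a -> deg_Qp_le v a n.
Proof.
move=> Ba.
have /boolp.choice [M HM] : forall i : nat, exists c : nat -> K, (forall j, inQp v (c j)) /\
    a * b ^+ i = \sum_(j < n) c j * b ^+ j.
  move=> i; have [|c Qc E] := @power_spanP b n (a * b ^+ i); last by exists c.
  by apply: power_spanM => //; apply: power_spanX; apply: power_span_b.
pose A : 'M[K]_n := \matrix_(i, j) M j i.
have [Qp1 QpD QpN QpM] := polyQp_ops HCp rho.
have Qp0 : polyQp v 0 by move=> i; rewrite coef0; apply: (inQp0 v rho).
exists (char_poly A); split.
- exact/monic_neq0/char_poly_monic.
- rewrite /char_poly /determinant; apply: (big_ind (polyQp v)) => // s _.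
  apply: (QpM); first by rewrite -signr_odd; case: odd; rewrite ?expr1 ?expr0 //; apply: QpN.
  apply: (big_ind (polyQp v)) => // i _; rewrite !mxE; apply: QpD.
    by case: (_ == _); rewrite ?mulr1n ?mulr0n //; apply: (polyQpX v rho 1).
  by apply: QpN; apply: (polyQpC rho); apply: (HM _).1.
- rewrite -eigenvalue_root_char; apply/eigenvalueP; exists (\row_j b ^+ j).
    apply/rowP => i; rewrite !mxE (HM i).2; apply: eq_bigr => j _.
    by rewrite !mxE mulrC.
  apply/eqP => /rowP /(_ (Ordinal n0)) /eqP; rewrite !mxE /= expr0.
  by rewrite oner_eq0.
- by rewrite size_char_poly.
Qed.

End Ring.

Variables (L : fieldType) (U : subringClosed L).
Hypothesis Uval : forall x : L, x \in U \/ x^-1 \in U.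
Hypothesis pNU : p%:R^-1 \notin U.
Variable kap : {rmorphism K -> L}.
Hypothesis kapU : forall x, (kap x \in U) = vge v x 0.

(** Induction on the digits. With the earlier partial sum [a] already in [B], the element
    [(b - a) / p^n] of [B] is congruent to the next digit modulo [p], and its iterated powers
    converge to that digit. *)
Lemma Teichmuller_sum_closure (B : K -> Prop) b n a :
  Qp_subspace B -> v_closed B -> (forall x k, B x -> B (x ^+ k)) -> B b ->
  Teichmuller_sum p n a -> vge v (b - a) n%:R -> B a.
Proof.
move=> HB clB BX Bb; elim=> [_|{n a}n a d tau d0 tauE _ IH ba]; first exact: (subspace0 HB).
have ktE : kap tau ^+ (p ^ d) = kap tau by rewrite -rmorphXn tauE.
have ktU := Teichmuller_integral p_pr Uval d0 ktE.
have vpt : vge v (p%:R ^+ n * tau) n%:R.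
  by rewrite mulrC -(vge_divp p_pr HCp rho) mulfK ?(pK_neq0 p_pr HCp) // -kapU.
have Ba : B a.
  apply: IH; rewrite (_ : b - a = (b - (a + p%:R ^+ n * tau)) + p%:R ^+ n * tau); last by ring.
  by apply: (vgeD HCp) => //; apply: vge_le ba; rewrite ler_nat.
have Qpp m : inQp v (p%:R ^+ m) by rewrite -(rmorph_nat rho) -rmorphXn; apply: inQp_rat.
apply: (subspaceD HB) => //; apply: (subspaceZ HB) => //.
pose y := (p%:R ^+ n)^-1 * (b - a).
have By : B y by apply: (subspaceZ HB); [apply: (inQp_inv HCp rho)|apply: (subspaceB HB)].
have D1 : pdiv_by p U 1 (kap y - kap tau).
  rewrite -rmorphB (pdiv_by_kap p_pr HCp kapU rho) -(vge_divp p_pr HCp rho) expr1.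
  move: ba; rewrite -(vge_divp p_pr HCp rho); congr (vge v _ _).
  rewrite /y exprS; field.
  by rewrite (pK_neq0 p_pr HCp) (natK_neq0 HCp) // prime_gt0.
have yU : kap y \in U by rewrite -(subrK (kap tau) (kap y)) rpredD // (pdiv_byU pNU D1).
apply: clB => N; exists (y ^+ ((p ^ d) ^ N)); first exact: BX.
rewrite -(pdiv_by_kap p_pr HCp kapU rho) rmorphB rmorphXn -pdiv_byN opprB.
by apply: (pdiv_by_le pNU (leqnSn N)); apply: (Teichmuller_lim p_pr pNU).
Qed.

Lemma Teichmuller_sum_minimal n a : Teichmuller_sum p n a -> minimal_pair v a n%:R.
Proof.
move=> Ta; split; first exact: (algebraic_alg_Qp _ (Teichmuller_sum_algebraic p_pr rho Ta)).
move=> b _ ba N [P [P0 QP Pb le_N]].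
have s2 : (1 < size P)%N by apply: root_size_gt1 Pb.
set m := (size P).-1 in le_N; have sP : size P = m.+1 by rewrite /m prednK // ltnW.
have m0 : (0 < m)%N by rewrite -ltnS -sP.
(* A relation of degree [m] for [b] makes the span of [m] powers a closed ring; it contains [a],
   whose degree is therefore at most [m]. *)
have bm : power_span b m (b ^+ m).
  have lc0 : P`_m != 0 by rewrite /m -lead_coefE lead_coef_eq0.
  have HB := power_span_subspace b m.
  have : P`_m * b ^+ m = - \sum_(i < m) P`_i * b ^+ i.
    apply/eqP; rewrite -addr_eq0 addrC; move: Pb; rewrite /root horner_coef sP big_ord_recr /=.
    by [].
  move/(canRL (mulKf lc0)) => ->; apply: (subspaceZ HB).
    by apply: (inQp_inv HCp rho); apply: QP.
  rewrite -sub0r; apply: (subspaceB HB); first exact: (subspace0 HB).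
  apply: (big_ind (power_span b m)); [exact: (subspace0 HB)|by move=> x y; apply: (subspaceD HB)|].
  move=> i _; apply: (subspaceZ HB); first exact: QP.
  by apply: (power_span_le (ltn_ord i)); apply: power_span_exp.
have [Q [Q0 QQ Qa sQ]] : deg_Qp_le v a m.
  apply: (power_span_deg m0 bm); apply: (Teichmuller_sum_closure _ _ _ _ Ta ba).
  - exact: power_span_subspace.
  - exact: power_span_closed.
  - by move=> x k; apply: power_spanX.
  - exact: power_span_b.
by exists Q; split=> //; apply: leq_trans le_N.
Qed.

End QpSpan.

(** * Fractions and elimination over Z_(p) *)


Section Fractions.
Variables (R : idomainType).
Local Open Scope quotient_scope.

Lemma fracP (z : {fraction R}) :
  exists f g : R, g != 0 /\ z = FracField.tofrac f / FracField.tofrac g.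
Proof.
elim/quotW: z => x; exists x.1, x.2; split; first exact: denom_ratioP.
apply: (canRL (mulfK _)); first by rewrite tofrac_eq0 denom_ratioP.
unlock FracField.tofrac; rewrite -[LHS]FracField.pi_mul.
apply/eqmodP; rewrite /= FracField.equivfE.
have x2 := denom_ratioP x.
by rewrite !numden_Ratio ?mulf_neq0 ?oner_neq0 // mulr1 [_ * x.1]mulrC -?mulrA ?mul1r ?mulr1 mulrC.
Qed.
End Fractions.

Local Notation T := (@FracField.tofrac _).

(** Universal property of the fraction field. The map is defined on chosen representatives, and
    [iotE] frees it from the choice. *)
Lemma frac_rmorphism (R : idomainType) (F : fieldType) (phi : {rmorphism R -> F}) :
  injective phi ->
  exists iot : {rmorphism {fraction R} -> F}, forall f, iot (T f) = phi f.
Proof.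
move=> phi_inj.
have phi0 g : g != 0 -> phi g != 0.
  by apply: contraNneq => g0; apply/eqP/phi_inj; rewrite g0 rmorph0.
have /boolp.choice [fg Hfg] : forall z : {fraction R}, exists fg : R * R,
    fg.2 != 0 /\ z = T fg.1 / T fg.2.
  by move=> z; have [f [g [g0 ->]]] := fracP z; exists (f, g).
pose iot z := phi (fg z).1 / phi (fg z).2.
have iotE f g : g != 0 -> iot (T f / T g) = phi f / phi g.
  move=> g0; have [h0 E] := Hfg (T f / T g); apply/eqP.
  rewrite /iot; set h := fg _ in h0 E *.
  rewrite eqr_div ?phi0 // -!rmorphM; apply/eqP; congr (phi _).
  move/eqP: E; rewrite eqr_div ?tofrac_eq0 // -!tofracM tofrac_eq => /eqP E.
  by rewrite E mulrC.
have T0 (g : R) : g != 0 -> T g != 0 by rewrite tofrac_eq0.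
have iotB : zmod_morphism iot.
  move=> x y; have [f [g [g0 ->]]] := fracP x; have [h [k [k0 ->]]] := fracP y.
  have -> : T f / T g - T h / T k = T (f * k - h * g) / T (g * k).
    by rewrite tofracB !tofracM -mulNr addf_div ?T0 // mulNr.
  by rewrite !iotE ?mulf_neq0 // rmorphB !rmorphM -[- (_ / _)]mulNr addf_div ?phi0 // mulNr.
have iotM : monoid_morphism iot.
  split=> [|x y].
    have -> : 1 = T (1 : R) / T 1 by rewrite divff // T0 ?oner_neq0.
    by rewrite iotE ?oner_neq0 // rmorph1 divr1.
  have [f [g [g0 ->]]] := fracP x; have [h [k [k0 ->]]] := fracP y.
  have -> : T f / T g * (T h / T k) = T (f * h) / T (g * k).
    by rewrite !tofracM mulf_div.
  by rewrite !iotE ?mulf_neq0 // !rmorphM mulf_div.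
exists (HB.pack_for {rmorphism {fraction R} -> F} iot
  (GRing.isZmodMorphism.Build _ _ iot iotB) (GRing.isMonoidMorphism.Build _ _ iot iotM)).
by move=> f /=; have := iotE f 1 (oner_neq0 R); rewrite tofrac1 rmorph1 !divr1.
Qed.

Lemma seq_min (T : eqType) (s : seq T) (P : pred T) (F : T -> rat) : has P s ->
  exists2 x, x \in s & P x /\ forall y, y \in s -> P y -> F x <= F y.
Proof.
elim: s => // x s IH /=; case Ps : (has P s).
  move=> _; have [y ys [Py ymin]] := IH Ps.
  case Px : (P x); last first.
    exists y; rewrite ?inE ?ys ?orbT //; split=> // z; rewrite inE => /orP [/eqP ->|]; last exact: ymin.
    by rewrite Px.
  have [xy|yx] := leP (F x) (F y).
    exists x; rewrite ?mem_head //; split=> // z; rewrite inE => /orP [/eqP -> //|zs Pz].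
    by apply: le_trans xy _; apply: ymin.
  exists y; rewrite ?inE ?ys ?orbT //; split=> // z; rewrite inE => /orP [/eqP -> _|]; last exact: ymin.
  exact: ltW.
rewrite orbF => Px; exists x; rewrite ?mem_head //; split=> // y.
rewrite inE => /orP [/eqP -> //|ys Py]; case/negP: (negbT Ps).
by apply/hasP; exists y.
Qed.

Section Elimination.
Variables (p : nat) (K : closedFieldType) (v : K -> rat).
Hypotheses (p_pr : prime p) (HCp : is_Cp p v).
Variable rho : {rmorphism rat -> K}.
Variable M : {poly rat} -> Prop.
Hypotheses (M0 : M 0) (MB : forall f g, M f -> M g -> M (f - g)).
Hypothesis MZ : forall c f, vge v (rho c) 0 -> M f -> M (c *: f).

(* Gaussian elimination over Z_(p): O_v is faithfully flat over Z_(p), so O_v M meets Q[X] in M. *)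
Lemma integral_span_rat (s : seq ({poly rat} * K)) g :
  {in s, forall x, M x.1 /\ vge v x.2 0} ->
  map_poly rho g = \sum_(x <- s) x.2 *: map_poly rho x.1 -> M g.
Proof.
have [n] := ubnP (size s); elim: n s g => // n IH s g le_n Ms E.
have coefE k : rho g`_k = \sum_(x <- s) x.2 * rho x.1`_k.
  rewrite -coef_map E coef_sum; apply: eq_bigr => x _.
  by rewrite coefZ coef_map.
have [[k sk]|nk] := boolp.EM (exists k, has (fun x : {poly rat} * K => x.1`_k != 0) s); last first.
  suff -> : g = 0 by [].
  apply/polyP => k; rewrite coef0; apply/eqP; rewrite -(fmorph_eq0 rho) coefE big_seq big1 // => x xs.
  have -> : x.1`_k = 0.
    by apply/eqP/negPn/negP => xk; apply: nk; exists k; apply/hasP; exists x.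
  by rewrite rmorph0 mulr0.
(* The pivot has least valuation in column [k], so all elimination factors [c y] lie in Z_(p).
   Subtracting multiples of the pivot leaves a combination of one vector fewer. *)
have [x xs [xk xmin]] := seq_min (fun x : {poly rat} * K => v (rho x.1`_k)) sk.
have [Mx _] := Ms x xs.
have rxk : rho x.1`_k != 0 by rewrite fmorph_eq0.
pose c (y : {poly rat} * K) := y.1`_k / x.1`_k.
have cO y : y \in s -> vge v (rho (c y)) 0.
  move=> ys; rewrite /c fmorph_div.
  have [->|yk] := eqVneq y.1`_k 0; first by rewrite rmorph0 mul0r /vge eqxx.
  have ryk : rho y.1`_k != 0 by rewrite fmorph_eq0.
  rewrite /vge mulf_eq0 invr_eq0 (negbTE ryk) (negbTE rxk) /=.
  by rewrite (vM HCp) ?invr_eq0 // (vV HCp) // subr_ge0 xmin.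
pose r := g`_k / x.1`_k.
have rE : rho r = \sum_(y <- s) y.2 * rho (c y).
  rewrite /r fmorph_div coefE mulr_suml; apply: eq_bigr => y _.
  by rewrite -mulrA -fmorph_div.
have rO : vge v (rho r) 0.
  rewrite rE big_seq; apply: (big_ind (fun z => vge v z 0)) => [||y ys]; first by rewrite /vge eqxx.
    by move=> y z; apply: (vgeD HCp).
  by have := vgeM HCp (Ms y ys).2 (cO y ys); rewrite addr0.
have -> : g = (g - r *: x.1) - (- r) *: x.1 by rewrite scaleNr opprK subrK.
apply: MB; last by apply: MZ => //; rewrite rmorphN (vgeN HCp).
have ps := perm_to_rem xs.
apply: (IH [seq (y.1 - c y *: x.1, y.2) | y <- rem x s]).
- by rewrite size_map size_rem // -ltnS (leq_trans _ le_n) // ltnS prednK //; case: (s) xs.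
- move=> _ /mapP [y ys ->] /=; have ys' : y \in s by apply: mem_rem ys.
  by have [My y2] := Ms y ys'; split=> //; apply: MB => //; apply: MZ => //; apply: cO.
rewrite big_map rmorphB /= map_polyZ /= E rE scaler_suml -sumrB.
rewrite (perm_big _ ps) big_cons /= /c divff // rmorph1 mulr1 subrr add0r.
by apply: eq_bigr => y _; rewrite rmorphB /= map_polyZ scalerBr scalerA.
Qed.

End Elimination.

(** * The p-adic closure of W *)


Lemma intq_ge1 (q : rat) : is_intq q -> 0 < q -> 1 <= q.
Proof.
move=> /eqP q1; have := divq_num_den q; rewrite q1 divr1 => <-.
by rewrite ltr0z ler1z gtz0_ge1.
Qed.

Section Unramified.
Variables (p : nat) (K : closedFieldType) (v : K -> rat).
Hypotheses (p_pr : prime p) (HCp : is_Cp p v).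
Variables (L : fieldType) (U : subringClosed L).
Hypothesis Uval : forall x, x \in U \/ x^-1 \in U.
Hypothesis pNU : p%:R^-1 \notin U.
Variable kap : {rmorphism K -> L}.
Hypothesis kapU : forall x, (kap x \in U) = vge v x 0.
Variable rho : {rmorphism rat -> K}.
Variable iot : {rmorphism QX -> L}.
Hypothesis iot_rat : forall q, iot (ratQX q) = kap (rho q).
Hypothesis iot_unram : forall x, x != 0 -> exists q : rat,
  [/\ q != 0, iot x / kap (rho q) \in U & kap (rho q) / iot x \in U].
Local Notation D := (pdiv_by p U).
Local Notation mx := (nonunit U).

Lemma D_p N : D N (kap (p%:R ^+ N)).
Proof. by rewrite rmorphXn rmorph_nat; apply: pdiv_by_pX. Qed.

Lemma vge_nonunit x : x != 0 -> mx (kap x) = (0 < v x).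
Proof.
move=> x0; rewrite /nonunit fmorph_eq0 (negbTE x0) /= -fmorphV kapU /vge invr_eq0.
by rewrite (negbTE x0) /= (vV HCp) // oppr_ge0 ltNge.
Qed.

Definition Wclosure z := z \in U /\ forall N, exists c, D N (z - iot c).
Local Notation What := Wclosure.

Lemma Wclosure_iot c : iot c \in U -> What (iot c).
Proof. by move=> cU; split=> // N; exists c; rewrite subrr /pdiv_by mul0r rpred0. Qed.

Lemma WclosureB y z : What y -> What z -> What (y - z).
Proof.
move=> [yU Hy] [zU Hz]; split=> [|N]; first exact: rpredB.
have [[b Hb] [c Hc]] := (Hy N, Hz N); exists (b - c).
rewrite rmorphB (_ : y - z - _ = (y - iot b) - (z - iot c)); last by ring.
exact: pdiv_byB.
Qed.

Lemma Wclosure0 : What 0.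
Proof. by rewrite -(rmorph0 iot); apply: Wclosure_iot; rewrite rmorph0 rpred0. Qed.

Lemma Wclosure1 : What 1.
Proof. by rewrite -(rmorph1 iot); apply: Wclosure_iot; rewrite rmorph1 rpred1. Qed.

Lemma WclosureD y z : What y -> What z -> What (y + z).
Proof.
move=> Hy Hz; rewrite -[z]opprK; apply: WclosureB => //; rewrite -sub0r.
by apply: WclosureB => //; apply: Wclosure0.
Qed.

Lemma WclosureM y z : What y -> What z -> What (y * z).
Proof.
move=> [yU Hy] [zU Hz]; split=> [|N]; first exact: rpredM.
have [[b Hb] [c Hc]] := (Hy N, Hz N); exists (b * c).
have cU : iot c \in U by rewrite -(subKr z (iot c)) rpredB // (pdiv_byU pNU Hc).
rewrite rmorphM (_ : _ - _ = y * (z - iot c) + iot c * (y - iot b)); last by ring.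
by apply: pdiv_byD; apply: pdiv_by_Ml.
Qed.

Lemma WclosureX z n : What z -> What (z ^+ n).
Proof.
move=> Hz; elim: n => [|n IH]; first exact: Wclosure1.
by rewrite exprS; apply: WclosureM.
Qed.

Lemma Wclosure_lim z : (forall N, exists2 y, What y & D N (z - y)) -> What z.
Proof.
move=> H; split=> [|N].
  have [y [yU _] D0] := H 0%N; rewrite -(subrK y z) rpredD //; exact: (pdiv_byU pNU D0).
have [y [_ /(_ N) [c Hc]] Hy] := H N; exists c.
by rewrite -(subrK y z) -addrA pdiv_byD.
Qed.

(** Modulo [p], [z] is an element [c] of Q(X), which up to units is a rational number [q] because
    [W] is unramified. A nonunit [q] has positive integral valuation, so at least 1. *)
Lemma Wclosure_nonunit z : What z -> mx z -> D 1 z.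
Proof.
move=> [zU /(_ 1%N) [c Hc]] mz.
suff Dc : D 1 (iot c) by rewrite -(subrK (iot c) z) pdiv_byD.
have [->|c0] := eqVneq c 0; first by rewrite rmorph0 /pdiv_by mul0r rpred0.
have mc : mx (iot c).
  rewrite -(subKr z (iot c)); apply: nonunitD => //.
  by rewrite nonunitN (pdiv_by_nonunit pNU).
have [q [q0 cq qc]] := iot_unram c0.
have rq0 : rho q != 0 by rewrite fmorph_eq0.
rewrite -(divfK (_ : kap (rho q) != 0) (iot c)) ?fmorph_eq0 //.
apply: pdiv_by_Ml => //; rewrite (pdiv_by_kap p_pr HCp kapU rho) // /vge (negbTE rq0) /=.
rewrite (val_rat HCp) //; apply: intq_ge1; first exact: padicv_int.
rewrite -(val_rat HCp rho) // -vge_nonunit //.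
rewrite -(divfK (_ : iot c != 0) (kap _)) ?fmorph_eq0 //.
exact: nonunitM.
Qed.

Lemma Wclosure_divp z : What z -> D 1 z -> What (z / p%:R).
Proof.
move=> [zU Hz] D1; split=> [|N]; first by move: D1; rewrite /pdiv_by expr1.
have [c Hc] := Hz N.+1; exists (c / ratQX p%:R).
rewrite fmorph_div iot_rat !rmorph_nat -mulrBl -(expr1 p%:R) pdiv_by_divp.
by rewrite add1n.
Qed.

(** An approximation [c] of [x] beyond the precision [v x] differs from it by a unit factor, and [c]
    differs from a rational number by a unit factor. Hence [v x] is the valuation of a rational
    number. *)
Lemma Wclosure_int x : What (kap x) -> x != 0 -> is_intq (v x).
Proof.
move=> [_ Hx] x0; have [N ltN] := rat_lt_nat (v x); have [c Hc] := Hx N.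
have kx0 : kap x != 0 by rewrite fmorph_eq0.
have mh : mx ((iot c - kap x) / kap x).
  rewrite (_ : _ / _ = ((iot c - kap x) / p%:R ^+ N) * kap (p%:R ^+ N / x)).
    apply: nonunitM; first by move: Hc; rewrite -pdiv_byN opprB.
    rewrite vge_nonunit ?mulf_neq0 ?invr_eq0 ?(pK_neq0 p_pr HCp) //.
    by rewrite (vM HCp) ?invr_eq0 ?(pK_neq0 p_pr HCp) // (val_pX p_pr HCp rho) // (vV HCp) // subr_gt0.
  rewrite fmorph_div rmorphXn rmorph_nat; field.
  by rewrite kx0 (pLX_neq0 pNU).
have hU := nonunitU Uval mh.
have [] := unit1D Uval hU mh; have := rpredD (rpred1 U) hU.
rewrite mulrBl divff // addrC subrK invf_div => ck kc c0'.
have c0 : c != 0 by apply: contraNneq c0' => ->; rewrite rmorph0 mul0r.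
have [q [q0 cq qc]] := iot_unram c0.
have rq0 : rho q != 0 by rewrite fmorph_eq0.
have ic0 : iot c != 0 by rewrite fmorph_eq0.
have krq0 : kap (rho q) != 0 by rewrite fmorph_eq0.
suff -> : v x = v (rho q) by rewrite (val_rat HCp) // padicv_int.
have val_le y z : y != 0 -> z != 0 -> kap y / kap z \in U -> v z <= v y.
  move=> y0 z0; rewrite -fmorph_div kapU /vge mulf_eq0 invr_eq0 (negbTE y0) (negbTE z0) /=.
  by rewrite (vM HCp) ?invr_eq0 // (vV HCp) // subr_ge0.
apply/eqP; rewrite eq_le; apply/andP; split; apply: val_le => //.
  have := rpredM qc ck.
  by rewrite mulrA divfK.
have := rpredM kc cq.
by rewrite mulrA divfK.
Qed.

(** [z^(p^d) - z] is a nonunit of the closure, hence divisible by [p], and [Teichmuller_pdiv] passes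
    this on to [z - tau]. Then [tau] is a limit of powers of [z]. *)
Lemma Wclosure_Teichmuller z d tau : (0 < d)%N -> tau ^+ (p ^ d) = tau -> What z ->
  mx (z - kap tau) -> What (kap tau) /\ What ((z - kap tau) / p%:R).
Proof.
move=> d0 tauE Hz mzt.
have ktE : kap tau ^+ (p ^ d) = kap tau by rewrite -rmorphXn tauE.
have tU : kap tau \in U by apply: (Teichmuller_integral p_pr Uval d0).
have zU := Hz.1.
have Hzq : What (z ^+ (p ^ d) - z) by apply: WclosureB => //; apply: WclosureX.
have D1 : D 1 (z - kap tau).
  apply: (Teichmuller_pdiv p_pr Uval pNU d0) => //; apply: Wclosure_nonunit => //.
  rewrite (_ : _ - z = (z ^+ (p ^ d) - kap tau ^+ (p ^ d)) - (z - kap tau)); last by rewrite ktE; ring.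
  apply: nonunitD => //; rewrite ?nonunitN //.
  rewrite subrXX mulrC; apply: nonunitM => //; apply: rpred_sum => i _.
  by rewrite rpredM // rpredX.
have Ht : What (kap tau).
  apply: Wclosure_lim => N; exists (z ^+ ((p ^ d) ^ N)); first exact: WclosureX.
  rewrite -pdiv_byN opprB; apply: (pdiv_by_le pNU (leqnSn N)).
  exact: (Teichmuller_lim p_pr pNU).
split=> //; apply: Wclosure_divp => //; exact: WclosureB.
Qed.

(** Equality of values under the valuation of [U], for nonzero elements. *)
Definition assoc x y := [/\ x != 0, y != 0, x / y \in U & y / x \in U].

Lemma assoc_divU x x' y y' : assoc x x' -> assoc y y' -> (x / y \in U) = (x' / y' \in U).
Proof.
move=> [x0 x'0 xx' x'x] [y0 y'0 yy' y'y]; apply/idP/idP => H.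
  have -> : x' / y' = (x' / x) * ((x / y) * (y / y')) by field; rewrite x0 y0 y'0.
  by do 2![apply: rpredM => //].
have -> : x / y = (x / x') * ((x' / y') * (y' / y)) by field; rewrite x'0 y0 y'0.
by do 2![apply: rpredM => //].
Qed.

Lemma assoc_M x x' y y' : assoc x x' -> assoc y y' -> assoc (x * y) (x' * y').
Proof.
move=> [x0 x'0 xx' x'x] [y0 y'0 yy' y'y].
by split; rewrite ?mulf_neq0 // invfM mulrACA rpredM.
Qed.

Lemma kap_divU x y : x != 0 -> y != 0 -> (kap x / kap y \in U) = (v y <= v x).
Proof.
move=> x0 y0; rewrite -fmorph_div kapU /vge mulf_eq0 invr_eq0 (negbTE y0) (negbTE x0) /=.
by rewrite (vM HCp) ?invr_eq0 // (vV HCp) // subr_ge0.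
Qed.

Local Notation X := (iot (toQX 'X)).
Hypothesis XU : X \in U.

Lemma iot_poly f : iot (toQX f) = (map_poly kap (map_poly rho f)).[X].
Proof.
elim/poly_ind: f => [|f c IH]; first by rewrite /toQX tofrac0 !rmorph0 horner0.
rewrite /toQX tofracD tofracM !rmorphD !rmorphM /= !map_polyC !map_polyX /= hornerMXaddC.
by congr (_ + _); [rewrite -IH|apply: iot_rat].
Qed.

(** Integral elements of Q_p are limits of rational numbers in [W], so they lie in the closure. A
    suitable power of [p] therefore brings any value at [a] of a polynomial over Q_p into the
    closure, where valuations are integers. *)
Lemma unramified_Wclosure a : What (kap a) -> unramified_Qp v a.
Proof.
move=> Ha.
have val_int x : x != 0 -> (exists k, What (kap (p%:R ^+ k * x))) -> is_intq (v x).
  move=> x0 [k Hk]; have := Wclosure_int Hk (mulf_neq0 (pK_neq0 p_pr HCp k) x0).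
  rewrite (vM HCp) ?(pK_neq0 p_pr HCp) // (val_pX p_pr HCp rho) // /is_intq -!Qint_def => H.
  by rewrite -(addKr k%:R (v x)) rpredD // rpredN rpred_nat.
have Qp_closure x : inQp v x -> vge v x 0 -> What (kap x).
  move=> Qx x0; apply: Wclosure_lim => N; have [q Hq] := (inQpE v rho x).1 Qx N.
  exists (kap (rho q)); last by rewrite -rmorphB (pdiv_by_kap p_pr HCp kapU rho).
  rewrite -iot_rat; apply: Wclosure_iot; rewrite iot_rat kapU -(subKr x (rho q)).
  by apply: (vgeB HCp) => //; apply: vge_le Hq.
have horner_closure f : polyQp v f -> exists k, What (kap (p%:R ^+ k * f.[a])).
  move=> Qf; rewrite horner_coef; apply: (big_ind (fun x => exists k, What (kap (p%:R ^+ k * x)))).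
  - by exists 0%N; rewrite mulr0 rmorph0; apply: Wclosure0.
  - move=> x y [k Hk] [l Hl]; exists (k + l)%N.
    have -> : p%:R ^+ (k + l) * (x + y) =
      p%:R ^+ l * (p%:R ^+ k * x) + p%:R ^+ k * (p%:R ^+ l * y) by rewrite exprD; ring.
    have Hp n : What (kap (p%:R ^+ n)).
      rewrite rmorphXn; apply: WclosureX; rewrite rmorph_nat -(rmorph_nat iot).
      by apply: Wclosure_iot; rewrite rmorph_nat rpred_nat.
    by rewrite rmorphD; apply: WclosureD; rewrite rmorphM; apply: WclosureM.
  - move=> i _; have [k Hk] := vge_bound v f`_i; exists k.
    rewrite mulrA rmorphM; apply: WclosureM; last by rewrite rmorphXn; apply: WclosureX.
    apply: Qp_closure; first by apply: (inQpM HCp rho) => //; rewrite -(rmorph_nat rho) -rmorphXn; apply: inQp_rat.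
    by rewrite mulrC; apply: (vge_mul_bound HCp Hk); rewrite add0r /vge (val_pX p_pr HCp rho) lexx orbT.
move=> g [f [h [Qf Qh f0 h0 ->]]].
have := val_int _ f0 (horner_closure _ Qf); have := val_int _ h0 (horner_closure _ Qh).
by rewrite /is_intq -!Qint_def => vh vf; rewrite rpredB.
Qed.

Lemma Wclosure_finite_ram a : What (kap a) -> in_Op v a /\ in_Cpbr v a.
Proof.
move=> Ha; split; first by rewrite /in_Op -kapU; case: Ha.
exists [:: 0] => g /(unramified_Wclosure Ha) gint; exists 0; first by rewrite inE.
by rewrite subr0.
Qed.

Lemma iot_neq0 f : f != 0 -> iot (toQX f) != 0.
Proof. by move=> f0; rewrite fmorph_eq0 tofrac_eq0. Qed.

(** * The Gauss valuation at an element with transcendental residue *)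

Section GaussValuation.
Variable Y : L.
Hypothesis YU : Y \in U.
Hypothesis Y_transc : forall d tau, (0 < d)%N -> tau ^+ (p ^ d) = tau -> ~~ mx (Y - kap tau).

(** A certificate that [v c] is the Gauss valuation of [P] and also the value of [P] at [Y]. It is
    multiplicative, which reduces its existence to linear factors. *)
Definition gauss (P : {poly K}) c :=
  (forall i, vge v (P`_i / c) 0) /\ assoc (map_poly kap P).[Y] (kap c).

(** For integral [r], take [c = 1]: [r] is congruent to a Teichmuller representative, so [Y - r] is
    a unit. Otherwise take [c = - r], as [Y - r] is [- r] times 1 minus the nonunit [Y / r]. *)
Lemma gauss_XsubC r : exists c, gauss ('X - r%:P) c.
Proof.
have coefP c : vge v c^-1 0 -> vge v (r / c) 0 -> forall i, vge v (('X - r%:P)`_i / c) 0.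
  move=> c1 rc i; rewrite coefB coefX coefC mulrBl; apply: (vgeB HCp).
    by case: (i == 1%N); rewrite ?mul1r // mul0r /vge eqxx.
  by case: (i == 0%N); rewrite // mul0r /vge eqxx.
case r0 : (vge v r 0).
  exists 1; split; first by apply: coefP; [rewrite invr1 /vge (v1 HCp) lexx orbT|rewrite divr1].
  rewrite map_polyXsubC hornerXsubC rmorph1.
  have YrU : Y - kap r \in U by rewrite rpredB // kapU.
  have [d [tau [d0 tauE mrt]]] := ex_Teichmuller p_pr HCp Uval pNU kapU rho r0.
  have [Yr0 YrV] : Y - kap r != 0 /\ (Y - kap r)^-1 \in U.
    apply: unitU => //; apply: contra (Y_transc d0 tauE) => mYr.
    rewrite (_ : Y - kap tau = (Y - kap r) + kap (r - tau)); last by rewrite rmorphB; ring.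
    exact: nonunitD.
  by split; rewrite ?oner_neq0 // ?divr1 ?div1r.
have r_neq0 : r != 0 by apply: contraFneq r0 => ->; rewrite /vge eqxx.
have kr0 : kap r != 0 by rewrite fmorph_eq0.
have mrV : mx (kap r)^-1 by apply: notU_nonunit; rewrite kapU r0.
exists (- r); split.
  apply: coefP.
    by rewrite -kapU fmorphV rmorphN invrN rpredN (nonunitU Uval).
  by rewrite invrN mulrN divff // (vgeN HCp) /vge (v1 HCp) lexx orbT.
rewrite map_polyXsubC hornerXsubC rmorphN.
have mt : mx (- (Y / kap r)) by rewrite nonunitN nonunitM.
have [uV u0] := unit1D Uval (nonunitU Uval mt) mt.
have E : Y - kap r = - kap r * (1 + - (Y / kap r)) by field.
split; rewrite ?oppr_eq0 //; rewrite E ?mulf_neq0 ?oppr_eq0 //.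
  by rewrite mulrC mulKf ?oppr_eq0 // rpredD ?rpred1 // (nonunitU Uval).
by rewrite invfM mulrA divff ?oppr_eq0 // mul1r.
Qed.

Lemma gauss_mul P Q b c : gauss P b -> gauss Q c -> gauss (P * Q) (b * c).
Proof.
move=> [Pb assP] [Qc assQ]; split; last by rewrite !rmorphM hornerM; apply: assoc_M.
move=> i; rewrite coefM mulr_suml.
apply: (big_ind (fun x => vge v x 0)) => [||j _]; first by rewrite /vge eqxx.
  by move=> x y; apply: (vgeD HCp).
by rewrite invfM mulrACA; have := vgeM HCp (Pb j) (Qc (i - j)%N); rewrite addr0.
Qed.

Lemma ex_gauss P : P != 0 -> exists c, gauss P c.
Proof.
move=> P0; have [s ->] := closed_field_poly_normal P.
have lc0 : lead_coef P != 0 by rewrite lead_coef_eq0.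
have [c Hc] : exists c, gauss (\prod_(z <- s) ('X - z%:P)) c.
  elim: s => [|z s [c Hc]].
    exists 1; rewrite big_nil; split=> [i|].
      by rewrite divr1 coefC; case: ifP => _; rewrite /vge ?eqxx // (v1 HCp) lexx orbT.
    by rewrite !rmorph1 hornerC; split; rewrite ?oner_neq0 // divff ?oner_neq0 // rpred1.
  by have [b Hb] := gauss_XsubC z; exists (b * c); rewrite big_cons; apply: gauss_mul.
exists (lead_coef P * c); rewrite -mul_polyC; apply: gauss_mul => //; split=> [i|].
  rewrite coefC; case: ifP => _; last by rewrite mul0r /vge eqxx.
  by rewrite divff // /vge (v1 HCp) lexx orbT.
rewrite map_polyC hornerC; have kc0 : kap (lead_coef P) != 0 by rewrite fmorph_eq0.
by split; rewrite ?divff ?rpred1.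
Qed.

(** If no coefficient attained the value of [c], every term of [P(Y) / c] would be a nonunit,
    although the sum is a unit. *)
Lemma gauss_min P c : gauss P c ->
  (exists i, P`_i != 0 /\ v P`_i = v c) /\ forall i, P`_i != 0 -> v c <= v P`_i.
Proof.
move=> [Pc [Y0 kc0 _ cY]]; have c0 : c != 0 by rewrite -(fmorph_eq0 kap).
have le_c i : P`_i != 0 -> v c <= v P`_i.
  move=> Pi0; have := Pc i; rewrite /vge mulf_eq0 invr_eq0 (negbTE Pi0) (negbTE c0) /=.
  by rewrite (vM HCp) ?invr_eq0 // (vV HCp) // subr_ge0.
split=> //; apply: boolp.contrapT => nex.
have mPY : mx ((map_poly kap P).[Y] / kap c).
  rewrite horner_coef mulr_suml.
  apply: (big_ind mx) => [||i _]; first by rewrite /nonunit eqxx.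
    by move=> x y; apply: nonunitD.
  rewrite mulrAC mulrC coef_map /= -fmorph_div; apply: nonunitM; first by rewrite rpredX.
  have [->|Pi0] := eqVneq P`_i 0; first by rewrite mul0r rmorph0 /nonunit eqxx.
  rewrite vge_nonunit ?mulf_neq0 ?invr_eq0 // (vM HCp) ?invr_eq0 // (vV HCp) // subr_gt0.
  by rewrite lt_neqAle le_c // andbT eq_sym; apply/eqP => vE; apply: nex; exists i.
by have := nonunitM cY mPY; rewrite mulrA divfK // divff // (negbTE (nonunit1 U)).
Qed.

End GaussValuation.

(** * The case of finite delta *)

Section FinitePair.
Variables (n : nat) (a : K).
Local Notation Y := ((X - kap a) / p%:R ^+ n).
Hypothesis YU : Y \in U.
Hypothesis Y_transc : forall d tau, (0 < d)%N -> tau ^+ (p ^ d) = tau -> ~~ mx (Y - kap tau).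

(** This is [f(a + p^n T)]. At [T = Y] it gives [f(X)], and the valuations of its coefficients are
    the terms of the monomial valuation at [(a, n)]; so the Gauss valuation computes both sides of
    [finite_pair]. *)
Let shifted f : {poly K} := shiftc a f \Po (p%:R ^+ n *: 'X).

Lemma coef_shifted f i : (shifted f)`_i = (shiftc a f)`_i * p%:R ^+ (n * i).
Proof.
rewrite /shifted; elim/poly_ind: (shiftc a f) i => [|g c IH] i.
  by rewrite comp_poly0 !coef0 mul0r.
rewrite comp_polyD comp_polyM comp_polyX comp_polyC !coefD !coefC -scalerAr coefZ !coefMX.
case: i => [|i] /=; first by rewrite muln0 !mulr0 mulr1.
by rewrite !addr0 IH mulnS exprD; ring.
Qed.

Lemma shifted_Y f : (map_poly kap (shifted f)).[Y] = iot (toQX f).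
Proof.
rewrite /shifted /shiftc !map_comp_poly !horner_comp map_polyZ rmorphD /= !map_polyX map_polyC.
rewrite hornerZ hornerD !hornerX hornerC rmorphXn rmorph_nat mulrC divfK ?(pLX_neq0 pNU) // subrK.
by rewrite (iot_poly f) (eq_map_poly (fmorph_eq_rat rho)).
Qed.

Lemma shifted_neq0 f : f != 0 -> shifted f != 0.
Proof. by move/iot_neq0; rewrite -shifted_Y; apply: contraNneq => ->; rewrite rmorph0 horner0. Qed.

Lemma finite_pair phi : iot phi \in U <-> inZpad v a (Some n) phi.
Proof.
have valE f i : (shiftc a f)`_i != 0 ->
    v (shiftc a f)`_i + i%:R * n%:R = v (shifted f)`_i /\ (shifted f)`_i != 0.
  move=> fi0; rewrite coef_shifted mulf_neq0 ?(pK_neq0 p_pr HCp) //; split=> //.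
  by rewrite (vM HCp) ?(pK_neq0 p_pr HCp) // (val_pX p_pr HCp rho) natrM [i%:R * _]mulrC.
have shift_neq0 f i : (shifted f)`_i != 0 -> (shiftc a f)`_i != 0.
  by rewrite coef_shifted mulf_eq0 negb_or => /andP [].
have key f g : g != 0 -> iot (toQX f / toQX g) \in U <-> mon_ge v a n%:R f g.
  move=> g0; rewrite fmorph_div.
  have [->|f0] := eqVneq f 0.
    rewrite /toQX tofrac0 rmorph0 mul0r rpred0; split=> // _ i.
    by rewrite /shiftc map_poly0 comp_poly0 coef0 eqxx.
  have [b Hb] := ex_gauss YU Y_transc (shifted_neq0 f0).
  have [c Hc] := ex_gauss YU Y_transc (shifted_neq0 g0).
  have [[i [fi0 vi]] fmin] := gauss_min YU Hb.
  have [[j [gj0 vj]] gmin] := gauss_min YU Hc.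
  have b0 : b != 0 by case: Hb => _ [_]; rewrite fmorph_eq0.
  have c0 : c != 0 by case: Hc => _ [_]; rewrite fmorph_eq0.
  rewrite -(shifted_Y f) -(shifted_Y g) (assoc_divU Hb.2 Hc.2) kap_divU //; split=> [cb k fk0|H].
    exists j; split; first exact: shift_neq0.
    have [-> fk] := valE _ _ fk0; have [-> _] := valE _ _ (shift_neq0 _ _ gj0).
    by rewrite vj (le_trans cb) // fmin.
  have [k [gk0 le_k]] := H i (shift_neq0 _ _ fi0).
  have [E1 _] := valE _ _ (shift_neq0 _ _ fi0); have [E2 gk] := valE _ _ gk0.
  by move: le_k; rewrite E1 E2 vi; apply: le_trans; apply: gmin.
split=> [phiU|[f [g [g0 -> H]]]]; last exact/key.
have [f [g [g0 E]]] := fracP phi; exists f, g; split=> //.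
by apply/key => //; rewrite -E.
Qed.

End FinitePair.

(** * The case of infinite delta *)

Section InfinitePair.
Variable a : K.
Hypothesis Xa : forall N, D N (X - kap a).

Definition inf_small x := forall N, D N x.

Lemma inf_smallD x y : inf_small x -> inf_small y -> inf_small (x + y).
Proof. by move=> Hx Hy N; apply: pdiv_byD. Qed.

(** The factor [c] need not be integral: its bounded denominator is absorbed by asking for [k] more
    powers of [p]. *)
Lemma inf_smallM c x : inf_small x -> inf_small (kap c * x).
Proof.
move=> Hx N; have [k Hk] := vge_bound v c; rewrite /pdiv_by.
have -> : kap c * x / p%:R ^+ N = kap (p%:R ^+ k * c) * (x / p%:R ^+ (k + N)).
  by rewrite rmorphM rmorphXn rmorph_nat exprD; field; rewrite !(pLX_neq0 pNU).
apply: rpredM; last exact: Hx.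
rewrite kapU mulrC; apply: (vge_mul_bound HCp Hk).
by rewrite add0r /vge (val_pX p_pr HCp rho) lexx orbT.
Qed.

(** Termwise, [X^i - a^i] is a multiple of [X - a] in [U]. *)
Lemma inf_small_horner f : inf_small (iot (toQX f) - kap (map_poly rho f).[a]).
Proof.
have aU : kap a \in U by rewrite -(subKr X (kap a)) rpredB // (pdiv_byU pNU (Xa 0%N)).
rewrite iot_poly -horner_map /= !horner_coef -sumrB.
apply: (big_ind inf_small) => [N||i _]; first by rewrite /pdiv_by mul0r rpred0.
  exact: inf_smallD.
rewrite -mulrBr coef_map; apply: inf_smallM => N; rewrite subrXX mulrC.
by apply: pdiv_by_Ml => //; apply: rpred_sum => j _; rewrite rpredM // rpredX.
Qed.

(** A nonzero element of Q(X) has the value of a nonzero rational number, which is not divisible by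
    all powers of [p]. Applied to [f(X) - f(a)], this makes [a] transcendental. *)
Lemma iot_inf_small x : inf_small (iot x) -> x = 0.
Proof.
move=> Hx; apply/eqP/negPn/negP => x0; have [q [q0 _ qx]] := iot_unram x0.
suff /eqP : rho q = 0 by rewrite fmorph_eq0 (negbTE q0).
apply: (@vge_eq0 K v) => N; rewrite -(pdiv_by_kap p_pr HCp kapU rho).
rewrite -(divfK (_ : iot x != 0) (kap _)) ?fmorph_eq0 //.
exact: pdiv_by_Ml.
Qed.

Lemma infinite_pair_neq0 f : f != 0 -> (map_poly rho f).[a] != 0.
Proof.
move=> f0; apply/eqP => fa; have := inf_small_horner f.
rewrite fa rmorph0 subr0 => /iot_inf_small /eqP; rewrite tofrac_eq0.
by rewrite (negbTE f0).
Qed.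

Lemma infinite_pair_transcendental : transcendental_Q a.
Proof.
by move=> f f0; rewrite -(eq_map_poly (fmorph_eq_rat rho)); apply: infinite_pair_neq0.
Qed.

(** [f(X)] is [f(a)] times [1 + h] with [h] divisible by all powers of [p]. *)
Lemma infinite_pair_assoc f : f != 0 -> assoc (iot (toQX f)) (kap (map_poly rho f).[a]).
Proof.
move=> f0; have fa0 := infinite_pair_neq0 f0; set c := (map_poly rho f).[a] in fa0 *.
have kc0 : kap c != 0 by rewrite fmorph_eq0.
set h := kap c^-1 * (iot (toQX f) - kap c).
have Dh : D 1 h by apply: inf_smallM; apply: inf_small_horner.
have hU := pdiv_byU pNU Dh.
have [uV u0] := unit1D Uval hU (pdiv_by_nonunit pNU Dh).
have E : iot (toQX f) = kap c * (1 + h) by rewrite /h fmorphV; field.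
split; rewrite ?E ?mulf_neq0 //; first by rewrite mulrAC divff // mul1r rpredD // rpred1.
by rewrite invfM mulrA divff // mul1r.
Qed.

Lemma infinite_pair phi : iot phi \in U <-> inZpad v a None phi.
Proof.
have key f g : g != 0 -> iot (toQX f / toQX g) \in U <->
    (map_poly ratr f).[a] = 0 \/ v (map_poly ratr g).[a] <= v (map_poly ratr f).[a].
  move=> g0; rewrite fmorph_div -!(eq_map_poly (fmorph_eq_rat rho)).
  have [->|f0] := eqVneq f 0.
    by rewrite /toQX tofrac0 !rmorph0 mul0r rpred0 horner0; split=> // _; left.
  rewrite (assoc_divU (infinite_pair_assoc f0) (infinite_pair_assoc g0)).
  rewrite kap_divU ?infinite_pair_neq0 //; split; first by right.
  by case=> // /eqP; rewrite (negbTE (infinite_pair_neq0 f0)).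
split=> [phiU|[f [g [g0 -> H]]]]; last exact/key.
have [f [g [g0 E]]] := fracP phi; exists f, g; split=> //.
by apply/key => //; rewrite -E.
Qed.

End InfinitePair.

(** * Digit-by-digit approximation of X *)

Definition approximant n b :=
  [/\ Teichmuller_sum p n b, What (kap b) & What ((X - kap b) / p%:R ^+ n)].

Lemma approximant0 : approximant 0 0.
Proof.
split; first exact: Tsum0.
  by rewrite rmorph0; apply: Wclosure0.
by rewrite rmorph0 subr0 divr1; apply: Wclosure_iot.
Qed.

Lemma approximant_next n b d tau : approximant n b -> (0 < d)%N -> tau ^+ (p ^ d) = tau ->
  mx ((X - kap b) / p%:R ^+ n - kap tau) ->
  exists2 b', approximant n.+1 b' & vge v (b' - b) n%:R.
Proof.
move=> [Tb Hb HY] d0 tauE mY; have [Ht HYt] := Wclosure_Teichmuller d0 tauE HY mY.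
exists (b + p%:R ^+ n * tau).
  split; first exact: TsumS tauE Tb.
    rewrite rmorphD rmorphM rmorphXn rmorph_nat; apply: WclosureD => //.
    apply: WclosureM => //; apply: WclosureX; rewrite -(rmorph_nat iot).
    by apply: Wclosure_iot; rewrite rmorph_nat rpred_nat.
  rewrite (_ : _ / _ = ((X - kap b) / p%:R ^+ n - kap tau) / p%:R) //.
  rewrite rmorphD rmorphM rmorphXn rmorph_nat exprS; field.
  by rewrite (pLX_neq0 pNU) (pL_neq0 pNU).
rewrite addrC addKr -(pdiv_by_kap p_pr HCp kapU rho) rmorphM mulrC.
by apply: pdiv_by_Ml; [case: Ht|apply: D_p].
Qed.

Lemma ex_pair : exists (a : K) (d : option nat),
  [/\ in_Op v a /\ in_Cpbr v a,
      admissible v a (omap (fun n : nat => n%:R : rat) d),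
      (forall n : nat, d = Some n -> minimal_pair v a n%:R),
      (forall phi : QX, iot phi \in U <-> inZpad v a d phi) &
      unramified_Qp v a].
Proof.
have [[n [b [[Tb Hb HY] Y_transc]]]|next] := boolp.EM (exists n b, approximant n b /\
  forall d tau, (0 < d)%N -> tau ^+ (p ^ d) = tau -> ~~ mx ((X - kap b) / p%:R ^+ n - kap tau)).
  have min_b := Teichmuller_sum_minimal p_pr HCp rho Uval pNU kapU Tb.
  exists b, (Some n); split.
  - exact: Wclosure_finite_ram.
  - by case: min_b.
  - by move=> _ [<-].
  - by move=> phi; apply: finite_pair => //; case: HY.
  - exact: unramified_Wclosure.
(* Every approximant now has a successor. The choice function is made total by the value 0 at pairs
   that are not approximants, and is iterated from 0. *)
have /boolp.choice [f Hf] : forall nb : nat * K, exists b', approximant nb.1 nb.2 ->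
    approximant nb.1.+1 b' /\ vge v (b' - nb.2) nb.1%:R.
  move=> [n b] /=; have [Hb|nHb] := boolp.EM (approximant n b); last by exists 0.
  suff [d [tau [d0 tauE mY]]] : exists d tau, [/\ (0 < d)%N, tau ^+ (p ^ d) = tau &
      mx ((X - kap b) / p%:R ^+ n - kap tau)].
    by have [b' Hb' bb'] := approximant_next Hb d0 tauE mY; exists b'.
  apply: boolp.contrapT => nex; apply: next; exists n, b; split=> // d tau d0 tauE.
  by apply/negP => mY; apply: nex; exists d, tau.
pose fix b n := if n is m.+1 then f (m, b m) else 0.
have Hb n : approximant n (b n).
  by elim: n => [|n IH]; [apply: approximant0|case: (Hf (n, b n) IH)].
have b_near n k : vge v (b (k + n)%N - b n) n%:R.
  elim: k => [|k IH]; first by rewrite subrr /vge eqxx.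
  rewrite -(subrK (b (k + n)%N) (b (k.+1 + n)%N)) -addrA; apply: (vgeD HCp) => //.
  have [_] := Hf (_, _) (Hb (k + n)%N); apply: vge_le.
  by rewrite ler_nat leq_addl.
have b_near' N n : (N <= n)%N -> vge v (b n - b N) N%:R by move=> /subnK <-.
have [a Ha] : exists a, forall N : nat, exists k, forall n, (k <= n)%N -> vge v (b n - a) N%:R.
  case: HCp => [_ _ _ H _]; apply: H => N; exists N => m n Nm Nn.
  rewrite (_ : _ - _ = (b m - b N) - (b n - b N)); last by ring.
  by apply: (vgeB HCp); apply: b_near'.
have Dba N : exists2 n, (N <= n)%N & D N (kap a - kap (b n)).
  have [k Hk] := Ha N; exists (maxn k N); first exact: leq_maxr.
  by rewrite -pdiv_byN opprB -rmorphB (pdiv_by_kap p_pr HCp kapU rho) Hk // leq_maxl.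
have Ka : What (kap a).
  apply: Wclosure_lim => N; have [n _ Dn] := Dba N; exists (kap (b n)) => //.
  by case: (Hb n).
(* Both [X - b_n] and [a - b_n] are divisible by [p^N] for a suitable [n >= N]. *)
have Xa N : D N (X - kap a).
  have [n Nn Dn] := Dba N; rewrite (_ : _ - _ = (X - kap (b n)) - (kap a - kap (b n))); last by ring.
  apply: pdiv_byB => //; apply: (pdiv_by_le pNU Nn).
  by have [_ _ []] := Hb n.
exists a, None; split=> //.
- exact: Wclosure_finite_ram.
- exact: infinite_pair_transcendental.
- exact: infinite_pair.
- exact: unramified_Wclosure.
Qed.

End Unramified.

(** * A common extension of W and v *)


Lemma DVR_subring (W : pred QX) : is_DVR W ->
  [/\ 1 \in W, (forall x y, x \in W -> y \in W -> x - y \in W) &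
      forall x y, x \in W -> y \in W -> x * y \in W].
Proof.
case=> w [wM wD _ WE].
have w1 : w 1 = 0.
  have := wM 1 1 (oner_neq0 _) (oner_neq0 _); rewrite mulr1 => /eqP.
  by rewrite -subr_eq0 opprD addNKr oppr_eq0 => /eqP.
have N1 : (-1 : QX) != 0 by rewrite oppr_eq0 oner_neq0.
have wN1 : w (-1) = 0.
  have := wM _ _ N1 N1; rewrite mulrNN mulr1 w1 => /esym /eqP.
  by rewrite -mulr2n mulrn_eq0 => /eqP.
have W1 : 1 \in W by apply/WE; right; rewrite w1.
have WM x y : x \in W -> y \in W -> x * y \in W.
  have [->|x0] := eqVneq x 0; first by rewrite mul0r.
  have [->|y0] := eqVneq y 0; first by rewrite mulr0.
  move=> /WE [/eqP|wx]; first by rewrite (negbTE x0).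
  move=> /WE [/eqP|wy]; first by rewrite (negbTE y0).
  by apply/WE; right; rewrite wM // addr_ge0.
have WN x : x \in W -> - x \in W.
  by move=> Wx; rewrite -mulN1r; apply: WM => //; apply/WE; right; rewrite wN1.
split=> // x y Wx /WN; move: (- y) => {}y Wy.
have [->|x0] := eqVneq x 0; first by rewrite add0r.
have [->|y0] := eqVneq y 0; first by rewrite addr0.
have [->|xy0] := eqVneq (x + y) 0; first by apply/WE; left.
move/WE: Wx => [/eqP|wx]; first by rewrite (negbTE x0).
move/WE: Wy => [/eqP|wy]; first by rewrite (negbTE y0).
by apply/WE; right; apply: le_trans (wD _ _ x0 y0 xy0); rewrite le_min wx.
Qed.

Section Extension.
Variables (p : nat) (K : closedFieldType) (v : K -> rat) (W : pred QX).
Hypotheses (p_pr : prime p) (HCp : is_Cp p v).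
Hypotheses (W1 : 1 \in W) (WB : forall x y, x \in W -> y \in W -> x - y \in W)
  (WM : forall x y, x \in W -> y \in W -> x * y \in W).
Hypothesis WQ : forall q : rat, ratQX q \in W <-> ~~ (p %| absz (denq q))%N.
Hypothesis W_unram : unramified_W W.
Variable rho : {rmorphism rat -> K}.

Variables (L : fieldType) (kap : {rmorphism K -> L}) (iot : {rmorphism QX -> L}).
Hypothesis iot_rat : forall q, iot (ratQX q) = kap (rho q).
Hypothesis compositum_free : forall (g : {poly rat}) (t : seq ({poly rat} * K)),
  iot (toQX g) = \sum_(x <- t) iot (toQX x.1) * kap x.2 ->
  map_poly rho g = \sum_(x <- t) x.2 *: map_poly rho x.1.

Let W_rat q : ratQX q \in W <-> vge v (rho q) 0.
Proof. by rewrite (vge_rat p_pr HCp); apply: WQ. Qed.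

Let W0 : 0 \in W. Proof. by rewrite -(subrr 1); apply: WB. Qed.

Let wo_sum (s : seq (QX * K)) : L := \sum_(x <- s) iot x.1 * kap x.2.
Let compositum (z : L) := exists2 s : seq (QX * K),
  {in s, forall x, x.1 \in W /\ vge v x.2 0} & z = wo_sum s.

Let WV : ratQX p%:R^-1 \notin W.
Proof.
apply/negP => /W_rat; rewrite fmorphV rmorph_nat /vge invr_eq0 (negbTE (natK_neq0 HCp (prime_gt0 p_pr))) /=.
by rewrite (vV HCp) ?(natK_neq0 HCp) ?prime_gt0 // (val_p p_pr HCp rho).
Qed.

(** Clearing denominators turns a sum in the compositum into a combination of polynomials over Q, to
    which [compositum_free] applies. *)
Let common_denominator (s : seq (QX * K)) : {in s, forall x, x.1 \in W /\ vge v x.2 0} ->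
  exists (g : {poly rat}) (t : seq ({poly rat} * K)), [/\ g != 0,
    {in t, forall x, toQX x.1 / toQX g \in W /\ vge v x.2 0} &
    iot (toQX g) * wo_sum s = \sum_(x <- t) iot (toQX x.1) * kap x.2].
Proof.
elim: s => [|[w c] s IH] Ws.
  by exists 1, [::]; split; rewrite ?oner_neq0 // /wo_sum !big_nil mulr0.
have [|g [t [g0 Wt E]]] := IH; first by move=> x xs; apply: Ws; rewrite inE xs orbT.
have [Ww cO] := Ws _ (mem_head _ _); rewrite /= in Ww cO.
have [f [h [h0]]] := fracP w; rewrite -/(toQX f) -/(toQX h) => wE.
have toQXM a b : toQX (a * b) = toQX a * toQX b by apply: tofracM.
have toQX0 a : a != 0 -> toQX a != 0 by rewrite tofrac_eq0.
exists (g * h), ((f * g, c) :: [seq (x.1 * h, x.2) | x <- t]); split.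
- by rewrite mulf_neq0.
- move=> x; rewrite inE => /orP [/eqP ->|/mapP [y yt ->]] /=; split=> //.
  + rewrite !toQXM [toQX g * _]mulrC -mulf_div divff ?toQX0 // mulr1.
    by rewrite -[toQX f / _]wE.
  + by rewrite !toQXM -mulf_div divff ?toQX0 // mulr1; case: (Wt y yt).
  + by case: (Wt y yt).
- rewrite /wo_sum !big_cons big_map /= -/(wo_sum s) mulrDr; congr (_ + _).
    rewrite mulrA -rmorphM; congr (iot _ * _).
    by rewrite wE !toQXM -mulrA [_ * (_ / _)]mulrC divfK ?toQX0 // mulrC.
  rewrite toQXM rmorphM mulrAC E mulr_suml; apply: eq_bigr => y _.
  by rewrite toQXM rmorphM mulrAC.
Qed.

(** If 1/p were in the compositum, a common denominator [g] would be an integral combination over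
    [O_v] of polynomials [p f] with [f / g] in [W]. These lie in the Z_(p)-module [M] of all [f]
    with [f / (p g)] in [W]; by elimination so does [g], which puts 1/p into [W]. *)
Lemma compositum_without : subring_without p%:R compositum.
Proof.
split.
- exists [:: (1, 1)] => [x|]; first by rewrite inE => /eqP -> /=; rewrite W1 /vge (v1 HCp) lexx orbT.
  by rewrite /wo_sum big_seq1 !rmorph1 mulr1.
- move=> _ _ [s Hs ->] [t Ht ->]; exists (s ++ [seq (- x.1, x.2) | x <- t]).
    move=> x; rewrite mem_cat => /orP [/Hs //|/mapP [y yt ->]] /=.
    by have [Wy yO] := Ht y yt; split=> //; rewrite -sub0r; apply: WB.
  rewrite /wo_sum big_cat /= big_map /= -sumrN; congr (_ + _); apply: eq_bigr => y _.
  by rewrite rmorphN mulNr.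
- move=> _ _ [s Hs ->] [t Ht ->]; exists [seq (x.1 * y.1, x.2 * y.2) | x <- s, y <- t].
    move=> z /allpairsP [[x y] /= [xs yt ->]] /=.
    have [[Wx xO] [Wy yO]] := (Hs x xs, Ht y yt); split; first exact: WM.
    by have := vgeM HCp xO yO; rewrite addr0.
  rewrite /wo_sum big_allpairs_dep mulr_suml; apply: eq_bigr => x _; rewrite mulr_sumr.
  by apply: eq_bigr => y _; rewrite !rmorphM mulrACA.
- case=> s Hs pE; have [g [t [g0 Ht E]]] := common_denominator Hs.
  have pL0 : p%:R != 0 :> L.
    by rewrite -(rmorph_nat kap) fmorph_eq0 (natK_neq0 HCp) ?prime_gt0.
  have pQ0 : (p%:R : rat) != 0 by rewrite pnatr_eq0 -lt0n prime_gt0.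
  have toQXZ c f : toQX (c *: f) = ratQX c * toQX f by rewrite -mul_polyC; apply: tofracM.
  have gE : map_poly rho g = \sum_(x <- [seq (p%:R *: x.1, x.2) | x <- t]) x.2 *: map_poly rho x.1.
    apply: compositum_free; rewrite big_map /=.
    rewrite -[LHS](mulfK pL0) mulrAC pE E mulr_suml; apply: eq_bigr => x _.
    by rewrite toQXZ rmorphM iot_rat !rmorph_nat mulrC mulrA.
  have toQX0 : toQX g != 0 by rewrite tofrac_eq0.
  have ratQXV : ratQX p%:R^-1 * ratQX p%:R = 1.
    by rewrite /ratQX /toQX -tofracM -polyCM mulVf // tofrac1.
  pose M (f : {poly rat}) := ratQX p%:R^-1 * (toQX f / toQX g) \in W.
  have : M g.
    apply: (@integral_span_rat p K v HCp rho M _ _ _ _ g _ gE).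
    + by rewrite /M /toQX tofrac0 mul0r mulr0.
    + by move=> f h Mf Mh; rewrite /M /toQX tofracB mulrBl mulrBr; apply: WB.
    + by move=> c f /W_rat Wc Mf; rewrite /M toQXZ -mulrA mulrCA; apply: WM.
    + move=> _ /mapP [x xt ->] /=; have [Wx xO] := Ht x xt; split=> //.
      by rewrite /M toQXZ -mulrA mulrA ratQXV mul1r.
  by rewrite /M divff // mulr1 => WpV; move: WV; rewrite WpV.
Qed.

Lemma ex_extension : exists U : subringClosed L,
  [/\ forall x, x \in U \/ x^-1 \in U, p%:R^-1 \notin U,
      forall x, (kap x \in U) = vge v x 0 & forall z, (iot z \in U) = (z \in W)].
Proof.
have [A [Amax cA]] := ex_maximal_without compositum_without.
have Aring := Amax.1.
have iotA z : z \in W -> A (iot z).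
  move=> Wz; apply: cA; exists [:: (z, 1)] => [x|]; last by rewrite /wo_sum big_seq1 rmorph1 mulr1.
  by rewrite inE => /eqP -> /=; rewrite Wz /vge (v1 HCp) lexx orbT.
have kapA x : vge v x 0 -> A (kap x).
  move=> xO; apply: cA; exists [:: (1, x)] => [y|]; last by rewrite /wo_sum big_seq1 rmorph1 mul1r.
  by rewrite inE => /eqP -> /=; rewrite W1.
have p0 : p%:R != 0 :> K by rewrite (natK_neq0 HCp) // prime_gt0.
have pL0 : p%:R != 0 :> L by rewrite -(rmorph_nat kap) fmorph_eq0.
have Ap : A p%:R.
  by rewrite -(rmorph_nat kap); apply: kapA; rewrite /vge (val_p p_pr HCp rho) ler01 orbT.
pose mem_A : {pred L} := fun x => boolp.asbool (A x).
have mem_AP x : reflect (A x) (x \in mem_A) by apply: boolp.asboolP.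
have A_subring : subring_closed mem_A.
  split=> [|x y /mem_AP Ax /mem_AP Ay|x y /mem_AP Ax /mem_AP Ay]; apply/mem_AP.
  - exact: (sw1 Aring).
  - exact: (swB Aring).
  - exact: (swM Aring).
pose U : subringClosed L := HB.pack_for (subringClosed L) mem_A
  (GRing.isSubringClosed.Build L mem_A A_subring).
have UP x : reflect (A x) (x \in U) by apply: mem_AP.
have kapU x : (kap x \in U) = vge v x 0.
  apply/UP/idP => [Akx|]; last exact: kapA.
  apply/negPn/negP => xO; apply: (swV Aring).
  have x0 : x != 0 by apply: contraNneq xO => ->; rewrite /vge eqxx.
  have vx : v x < 0 by move: xO; rewrite /vge negb_or -ltNge => /andP [].
  (* With this [k] the valuation of [x^k] is below -1, so [x^k * p] has an integral inverse and 1/p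
     would lie in [U]. *)
  have [k lt_k] := rat_lt_nat (- (v x)^-1).
  have -> : p%:R^-1 = kap (x ^+ k * p%:R)^-1 * kap x ^+ k.
    rewrite fmorphV rmorphM rmorphXn rmorph_nat invfM mulrAC mulVf ?mul1r //.
    by rewrite expf_neq0 // fmorph_eq0.
  apply: (swM Aring).
    apply: kapA; rewrite /vge invr_eq0 mulf_eq0 expf_eq0 (negbTE x0) (negbTE p0) andbF /=.
    rewrite (vV HCp) ?mulf_neq0 ?expf_neq0 // (vM HCp) ?expf_neq0 // (vX HCp) // (val_p p_pr HCp rho).
    have : - (v x)^-1 * - v x = 1 by rewrite mulrNN mulVf // lt_eqF.
    by nra.
  by apply/UP; rewrite rpredX //; apply/UP.
exists U; split=> //.
- move=> x; case: (maximal_without_valuation pL0 Ap Amax x) => [Ax|AxV].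
    by left; apply/UP.
  by right; apply/UP.
- by apply/UP; apply: (swV Aring).
move=> z; apply/UP/idP => [Az|]; last exact: iotA.
have [->//|z0] := eqVneq z 0.
(* Up to units of [W], [z] is a rational number [q], so [U] meets Q(X) in [W] as soon as it meets
   [K] in [O_v]. *)
have [q [q0 zq qz]] := W_unram z0.
have [rO|rO] := boolP (vge v (rho q) 0).
  have rq0 : ratQX q != 0 by rewrite tofrac_eq0 polyC_eq0.
  by rewrite -(divfK rq0 z); apply: WM => //; apply/W_rat.
case/negP: rO; rewrite -kapU -iot_rat -(divfK z0 (ratQX q)) rmorphM.
by apply/UP; apply: (swM Aring) => //; apply: iotA.
Qed.

End Extension.

(** * The two implications *)


Section FunctionField.
Variables (K : closedFieldType) (rho : {rmorphism rat -> K}).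
Local Notation L := {fraction {poly K}}.
Local Notation toL := (@FracField.tofrac {poly K}).

(** Inside K(X), a relation between images of polynomials already holds in K[X]. *)
Lemma ex_function_field_embeddings :
  exists (kap : {rmorphism K -> L}) (iot : {rmorphism QX -> L}),
  (forall q, iot (ratQX q) = kap (rho q)) /\
  (forall (g : {poly rat}) (t : seq ({poly rat} * K)),
    iot (toQX g) = \sum_(x <- t) iot (toQX x.1) * kap x.2 ->
    map_poly rho g = \sum_(x <- t) x.2 *: map_poly rho x.1).
Proof.
have inj : injective (toL \o map_poly rho).
  by move=> f g /= /eqP; rewrite tofrac_eq => /eqP; apply: map_poly_inj.
have [iot iotE] := frac_rmorphism inj; exists (toL \o polyC), iot.
split=> [q|g t]; first by rewrite iotE /= map_polyC.
rewrite iotE /= => E; apply/eqP; rewrite -tofrac_eq E rmorph_sum; apply/eqP.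
by apply: eq_bigr => x _; rewrite iotE /= -mul_polyC tofracM mulrC.
Qed.

End FunctionField.

(** * From a pair to an unramified ring *)

Section Converse.
Variables (p : nat) (K : closedFieldType) (v : K -> rat).
Hypotheses (p_pr : prime p) (HCp : is_Cp p v).
Variable rho : {rmorphism rat -> K}.

Lemma ex_rat_val r : is_intq r -> exists2 q, q != 0 & v (rho q) = r.
Proof.
move=> /eqP r1; have p0 : (p%:R : rat) != 0 by rewrite pnatr_eq0 -lt0n prime_gt0.
have := divq_num_den r; rewrite r1 divr1 => <-; case: (numq r) => n.
  by exists (p%:R ^+ n); [rewrite expf_neq0|rewrite rmorphXn rmorph_nat (val_pX p_pr HCp rho)].
exists (p%:R ^- n.+1); first by rewrite invr_eq0 expf_neq0.
rewrite fmorphV rmorphXn rmorph_nat (vV HCp) ?(pK_neq0 p_pr HCp) // (val_pX p_pr HCp rho).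
by rewrite NegzE rmorphN.
Qed.

Lemma unramified_val_int a f : unramified_Qp v a -> polyQp v f -> f.[a] != 0 -> is_intq (v f.[a]).
Proof.
move=> Ua Qf fa; apply: Ua; exists f, 1; split=> //.
- by case: (polyQp_ops HCp rho).
- by rewrite hornerC oner_neq0.
- by rewrite hornerC (v1 HCp) subr0.
Qed.

(** The Taylor coefficients of [f] at [a] are rational polynomials in [a], so their valuations lie
    in the value group of Q_p(a). *)
Lemma coef_shiftc_horner (a : K) f i : exists h, (shiftc a f)`_i = (map_poly rho h).[a].
Proof.
elim/poly_ind: f i => [|f c IH] i.
  by exists 0; rewrite /shiftc !map_poly0 comp_poly0 coef0 horner0.
have -> : shiftc a (f * 'X + c%:P) = shiftc a f * ('X + a%:P) + (rho c)%:P.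
  rewrite /shiftc -!(eq_map_poly (fmorph_eq_rat rho)) rmorphD rmorphM /= map_polyX map_polyC.
  by rewrite comp_polyD comp_polyM comp_polyX comp_polyC.
have [h1 E1] : exists h, (shiftc a f * 'X)`_i = (map_poly rho h).[a].
  rewrite coefMX; case: i => [|i] /=; last exact: IH.
  by exists 0; rewrite rmorph0 horner0.
have [h2 E2] := IH i.
exists (h1 + h2 * 'X + (if i == 0%N then c else 0)%:P).
rewrite coefD mulrDr coefD coefMC coefC E1 E2.
rewrite !rmorphD rmorphM /= map_polyX map_polyC !hornerD hornerM hornerX hornerC.
congr (_ + _); case: (i) => [|k] /=; by rewrite ?rmorph0.
Qed.

Lemma shiftc_neq0 (a : K) f : f != 0 -> shiftc a f != 0.
Proof.
move=> f0; rewrite /shiftc -(eq_map_poly (fmorph_eq_rat rho)) comp_poly2_eq0 ?map_poly_eq0 //.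
by rewrite size_XaddC.
Qed.

Lemma shiftcZ (a : K) c f i : (shiftc a (c *: f))`_i = rho c * (shiftc a f)`_i.
Proof.
by rewrite /shiftc -!(eq_map_poly (fmorph_eq_rat rho)) map_polyZ /= comp_polyZ coefZ.
Qed.

Lemma unramified_of_pair (W : pred QX) a d :
  admissible v a (omap (fun n : nat => n%:R : rat) d) ->
  (forall phi : QX, phi \in W <-> inZpad v a d phi) ->
  unramified_Qp v a -> unramified_W W.
Proof.
move=> adm WE Ua x x0; have [f [g [g0 xE]]] := fracP x.
have f0 : f != 0 by apply: contraNneq x0 => f0; rewrite xE f0 tofrac0 mul0r.
have toQX0 h : h != 0 -> toQX h != 0 by rewrite tofrac_eq0.
have divE q : q != 0 -> x / ratQX q = toQX f / toQX (q *: g) /\ ratQX q / x = toQX (q *: g) / toQX f.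
  move=> q0; rewrite -mul_polyC /toQX tofracM -/(toQX g) -/(toQX f) -/(toQX q%:P) -/(ratQX q) xE.
  by rewrite -/(toQX f) -/(toQX g) invfM mulrA mulrAC invf_div mulrA.
case: d adm WE => [n|] /= adm WE.
  have val_int h i : (shiftc a h)`_i != 0 -> is_intq (v (shiftc a h)`_i + i%:R * n%:R).
    have [k E] := coef_shiftc_horner a h i; rewrite E => ka.
    have := unramified_val_int Ua (polyQp_rat v rho k) ka.
    by rewrite /is_intq -!Qint_def => H; rewrite rpredD // rpredM ?rpred_nat.
  have val_min h : h != 0 -> exists2 i, (shiftc a h)`_i != 0 & forall j, (shiftc a h)`_j != 0 ->
      v (shiftc a h)`_i + i%:R * n%:R <= v (shiftc a h)`_j + j%:R * n%:R.
    move=> h0; have sh0 := shiftc_neq0 a h0.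
    have hasP' : has (fun i => (shiftc a h)`_i != 0) (iota 0 (size (shiftc a h))).
      apply/hasP; exists (size (shiftc a h)).-1; last by rewrite -lead_coefE lead_coef_eq0.
      by rewrite mem_iota add0n prednK ?leqnn // size_poly_gt0.
    have [i _ [hi imin]] := seq_min (fun i : nat => v (shiftc a h)`_i + i%:R * n%:R) hasP'.
    exists i => // j hj; apply: imin => //; rewrite mem_iota add0n /= ltnNge.
    by apply: contra hj => ?; rewrite nth_default.
  have [i fi imin] := val_min f f0; have [j gj jmin] := val_min g g0.
  (* The minima at [i] and [j] are the values of [f] and [g]. Both are integers, so some rational
     [q] has the value of [f / g]. *)
  have [|q q0 vq] := @ex_rat_val (v (shiftc a f)`_i + i%:R * n%:R - (v (shiftc a g)`_j + j%:R * n%:R)).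
    have := val_int _ _ fi; have := val_int _ _ gj.
    by rewrite /is_intq -!Qint_def => H1 H2; rewrite rpredB.
  have rq0 : rho q != 0 by rewrite fmorph_eq0.
  have [E1 E2] := divE q q0.
  exists q; split=> //; rewrite ?E1 ?E2; apply/WE.
    exists f, (q *: g); split; rewrite ?scaler_eq0 ?(negbTE q0) // => k fk.
    exists j; rewrite shiftcZ mulf_neq0 //; split=> //.
    by rewrite (vM HCp) // vq; have := imin k fk; lra.
  exists (q *: g), f; split=> // k; rewrite shiftcZ mulf_eq0 negb_or => /andP [_ gk].
  exists i; split=> //; rewrite (vM HCp) // vq.
  by have := jmin k gk; lra.
have ev0 h : h != 0 -> (map_poly rho h).[a] != 0.
  by move=> /adm; rewrite -(eq_map_poly (fmorph_eq_rat rho)).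
have val_int h : h != 0 -> is_intq (v (map_poly rho h).[a]).
  by move=> h0; apply: unramified_val_int => //; [apply: polyQp_rat|apply: ev0].
have [|q q0 vq] := @ex_rat_val (v (map_poly rho f).[a] - v (map_poly rho g).[a]).
  have := val_int _ f0; have := val_int _ g0.
  by rewrite /is_intq -!Qint_def => H1 H2; rewrite rpredB.
have rq0 : rho q != 0 by rewrite fmorph_eq0.
have [E1 E2] := divE q q0.
have vqg : v (map_poly rho (q *: g)).[a] = v (map_poly rho f).[a].
  by rewrite map_polyZ /= hornerZ (vM HCp) ?ev0 // vq subrK.
exists q; split=> //; rewrite ?E1 ?E2; apply/WE.
  exists f, (q *: g); split; rewrite ?scaler_eq0 ?(negbTE q0) //; right.
  by rewrite -!(eq_map_poly (fmorph_eq_rat rho)) vqg.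
exists (q *: g), f; split=> //; right.
by rewrite -!(eq_map_poly (fmorph_eq_rat rho)) vqg.
Qed.

End Converse.

Theorem mainTheorem12 (p : nat) (K : closedFieldType) (v : K -> rat)
    (W : pred QX) :
  prime p -> is_Cp p v ->
  is_DVR W ->
  (forall q : rat, ratQX q \in W <-> ~~ (p %| absz (denq q))%N) ->
  toQX 'X \in W ->
  (unramified_W W <->
   exists (a : K) (d : option nat),
     [/\ in_Op v a /\ in_Cpbr v a,
         admissible v a (omap (fun n : nat => n%:R : rat) d),
         (forall n : nat, d = Some n -> minimal_pair v a n%:R),
         (forall phi : QX, phi \in W <-> inZpad v a d phi) &
         unramified_Qp v a]).
Proof.
move=> p_pr HCp W_DVR WQ WX.
have [rho] := ex_rat_rmorphism (natK_neq0 HCp).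
split=> [W_unram|[a [d [_ adm _ WE Ua]]]]; last exact: (unramified_of_pair p_pr HCp rho adm WE Ua).
have [W1 WB WM] := DVR_subring W_DVR.
have [kap [iot [iot_rat free]]] := ex_function_field_embeddings rho.
have [U [Uval pNU kapU iotU]] := ex_extension p_pr HCp W1 WB WM WQ W_unram iot_rat free.
have unram x : x != 0 -> exists q : rat,
    [/\ q != 0, iot x / kap (rho q) \in U & kap (rho q) / iot x \in U].
  by move=> /W_unram [q [q0 xq qx]]; exists q; rewrite -iot_rat -!fmorph_div !iotU.
have XU : iot (toQX 'X) \in U by rewrite iotU.
have [a [d [aO adm mn UE Ua]]] := ex_pair p_pr HCp Uval pNU kapU iot_rat unram XU.
by exists a, d; split=> // phi; rewrite -iotU.
Qed.
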